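(* Let $A$, $Q$, $q$, $\sigma$ and $H_{A,Q}$ be as in the context. Then: (1) If $q\ge 5$ and $\langle\mathfrak S(Q),\sigma\rangle$ contains the alternating group $\mathcal A_q$, then $Q$ contains an iet that is not a rotation, and $H_{A,Q}$ is elementary amenable of Chou class $EG_2$ (i.e. it belongs to $EG_2$), is not virtually nilpotent, contains a free semigroup on two generators and has exponential growth. Moreover $H_{A,Q}$ is not virtually solvable and it is not a linear group. (2) Let $p\ge 1$ be an integer. The group $H_{A,Q}$ is $p$-solvable if and only if the group $\langle\mathfrak S(Q),\sigma\rangle$ is $p$-solvable.
   Context: An interval exchange transformation (iet) is a bijection $f:[0,1)\to[0,1)$ for which there is a finite partition of $[0,1)$ into half-open intervals $[a,b)$ on each of which $f$ is a translation. The iets form a group $\mathrm{IET}$ under composition. For $a\in\mathbb R/\mathbb Z$, $R_a\in\mathrm{IET}$ is the rotation $x\mapsto x+a \bmod 1$. For an integer $q\ge 1$ let $I_i=[\frac{i-1}{q},\frac{i}{q})$, $1\le i\le q$. For $\tau$ in the symmetric group $\mathcal S_q$ on $\{1,\dots,q\}$, $E_\tau$ is the iet that is a translation on each $I_i$ with $E_\tau(I_i)=I_{\tau(i)}$. Put $\mathcal G_{1/q}=\{E_\tau:\tau\in\mathcal S_q\}$; the map $\mathfrak S:\mathcal G_{1/q}\to\mathcal S_q$, $E_\tau\mapsto\tau$, is an isomorphism. $\sigma=\sigma_q$ is the $q$-cycle $(1,2,\dots,q)\in\mathcal S_q$. Setup: $s,m,q\geq 1$ are integers; $\alpha_1,\dots,\alpha_s\in(\mathbb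 R/\mathbb Z)\setminus(\mathbb Q/\mathbb Z)$ are $\mathbb Q$-independent (i.e. $\sum n_i\alpha_i=0$ in $\mathbb R/\mathbb Z$ with $n_i\in\mathbb Z$ forces all $n_i=0$; equivalently, for real representatives, $1,\alpha_1,\dots,\alpha_s$ are linearly independent over $\mathbb Q$); $A=\langle\alpha_1,\dots,\alpha_s\rangle\simeq\mathbb Z^s$ is the subgroup of $\mathbb R/\mathbb Z$ they generate; $g_1,\dots,g_m\in\mathcal G_{1/q}$ and $Q=\langle g_1,\dots,g_m\rangle\le\mathcal G_{1/q}$; and $H_{A,Q}=\langle R_{\alpha_1},\dots,R_{\alpha_s},g_1,\dots,g_m\rangle\le\mathrm{IET}$. Chou classes: $EG_0$ is the class of groups that are finite or abelian; $EG_{n+1}$ is the class of groups obtained from groups in $EG_n$ by one group extension or one direct union. A group is elementary amenable if it belongs to the smallest class containing finite and abelian groups and closed under subgroups, quotients, extensions and direct unions. A group $G$ is $p$-solvable ($p\ge1$) if its derived length is exactly $p$: $D^p(G)=\{\mathrm{Id}\}$ and $D^{p-1}(G)\neq\{\mathrm{Id}\}$, where $D^0(G)=G$ and $D^{k+1}(G)=[D^k(G),D^k(G)]$. A group is virtually solvable if it has a solvable subgroup of finite index. A linear group is a group isomorphic to a subgroup of $GL_n(K)$ for some $n$ and some field $K$.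
   Formalization: In part (2) the case q = 1, p = 1 is excluded: there ⟨𝔖(Q),σ⟩ is trivial, hence not 1-solvable (derived length exactly 1), whereas H_{A,Q} ≅ Z^s is nontrivial abelian, hence 1-solvable, so the equivalence fails. *)

(* Defs.v *)
From HB Require Import structures.
From mathcomp Require Import all_boot all_order all_algebra all_fingroup all_solvable.
From mathcomp Require Import ring lra.
From mathcomp Require Import boolp classical_sets functions cardinality reals.

Set Implicit Arguments.
Unset Strict Implicit.
Unset Printing Implicit Defensive.

Import Order.TTheory GRing.Theory Num.Theory.

(** * Subgroups of a possibly infinite group *)

Section Generated.
Variable G : groupType.
Local Open Scope group_scope.

Definition gen (A : set G) : {pred G} :=
  fun x => `[< forall S : groupClosed G, (forall a, A a -> a \in S) -> x \in S >].

Variable A : set G.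

Lemma genP x :
  reflect (forall S : groupClosed G, (forall a, A a -> a \in S) -> x \in S)
          (x \in gen A).
Proof. exact: asboolP. Qed.

Fact gen_mulg_closed : mulg_closed (gen A).
Proof.
move=> x y /genP Ax /genP Ay; apply/genP => S AS.
by apply: gpredM; [apply: Ax | apply: Ay].
Qed.

Fact gen_one : 1 \in gen A.
Proof. by apply/genP => S _; apply: gpred1. Qed.

Fact gen_invg_closed : invg_closed (gen A).
Proof. by move=> x /genP Ax; apply/genP => S AS; apply: gpredVr; apply: Ax. Qed.

HB.instance Definition _ := isMulClosed.Build G (gen A) gen_mulg_closed.
HB.instance Definition _ := isMul1Closed.Build G (gen A) gen_one.
HB.instance Definition _ := isInvClosed.Build G (gen A) gen_invg_closed.

End Generated.

Definition subgrp (G : groupType) (S : groupClosed G) : Type := {x : G | x \in S}.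

Section SubgroupType.
Variables (G : groupType) (S : groupClosed G).

Fact groupClosed_group_closed : group_closed (S : {pred G}).
Proof. by split; [exact: gpred1 | exact: gpredF]. Qed.

HB.instance Definition _ := SubChoice.on (subgrp S).
HB.instance Definition _ :=
  SubChoice_isSubGroup.Build G (fun x => x \in S) (subgrp S)
    groupClosed_group_closed.
End SubgroupType.

(** * Group-theoretic properties *)

Section GroupProperties.
Implicit Type G : groupType.
Local Open Scope classical_set_scope.
Local Open Scope group_scope.

Definition finite_grp G : Prop := finite_set [set: G].

Definition abelian_grp G : Prop := forall x y : G, commute x y.

(** [G] is an extension of [K] by [N]: [1 -> N -> G -> K -> 1] is exact. *)
Definition is_extension (N G K : groupType) : Prop :=
  exists (i : {multiplicative N -> G}) (p : {multiplicative G -> K}),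
    [/\ injective i, range p = [set: K] & forall x, p x = 1 <-> range i x].

Definition is_direct_union G (I : Type) (F : I -> groupClosed G) : Prop :=
  [/\ inhabited I,
      forall i j, exists k, {subset F i <= F k} /\ {subset F j <= F k}
    & forall x : G, exists i, x \in F i].

Fixpoint EG (n : nat) G : Prop :=
  match n with
  | 0 => finite_grp G \/ abelian_grp G
  | n'.+1 =>
      (exists N K : groupType, [/\ is_extension N G K, EG n' N & EG n' K]) \/
      (exists (I : Type) (F : I -> groupClosed G),
          is_direct_union F /\ forall i, EG n' (subgrp (F i)))
  end.

Inductive elementary_amenable : groupType -> Prop :=
| EA_finite G : finite_grp G -> elementary_amenable G
| EA_abelian G : abelian_grp G -> elementary_amenable G
| EA_subgroup G (S : groupClosed G) :
    elementary_amenable G -> elementary_amenable (subgrp S)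
| EA_quotient G (K : groupType) (p : {multiplicative G -> K}) :
    range p = [set: K] -> elementary_amenable G -> elementary_amenable K
| EA_extension (N G K : groupType) : is_extension N G K ->
    elementary_amenable N -> elementary_amenable K -> elementary_amenable G
| EA_direct_union G (I : Type) (F : I -> groupClosed G) : is_direct_union F ->
    (forall i, elementary_amenable (subgrp (F i))) -> elementary_amenable G.

Fixpoint derived G (n : nat) : {pred G} :=
  if n is n'.+1 then
    gen [set [~ x, y] | x in [set` @derived G n'] & y in [set` @derived G n']]
  else predT.

Fixpoint lower_central G (n : nat) : {pred G} :=
  if n is n'.+1 then
    gen [set [~ x, y] | x in [set` @lower_central G n'] & y in [set: G]]
  else predT.

Definition trivial_sub G (S : {pred G}) : Prop := [set` S] = [set 1].

Definition solvable_grp G : Prop := exists n, trivial_sub (@derived G n).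

Definition nilpotent_grp G : Prop := exists n, trivial_sub (@lower_central G n).

(** Derived length exactly [p]; meant for [p >= 1] only. *)
Definition p_solvable (p : nat) G : Prop :=
  trivial_sub (@derived G p) /\ ~ trivial_sub (@derived G p.-1).

Definition finite_index G (S : groupClosed G) : Prop :=
  finite_set (range (fun x : G => [set x * y | y in [set` (S : {pred G})]])).

Definition virtually (P : groupType -> Prop) G : Prop :=
  exists2 S : groupClosed G, finite_index S & P (subgrp S).

Definition linear_grp G : Prop :=
  exists (K : fieldType) (n : nat) (rho : G -> 'M[K]_n),
    [/\ injective rho, forall x, rho x \in unitmx
      & forall x y, rho (x * y) = (rho x *m rho y)%R].

Definition has_free_semigroup2 G : Prop :=
  exists a b : G, forall u v : seq bool, u != [::] -> v != [::] ->
    \prod_(i <- u) (if i then a else b) = \prod_(i <- v) (if i then a else b) ->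
    u = v.

(** Duplicate-free list of the products of at most [n] elements of
    [S] and their inverses. *)
Fixpoint ball G (S : seq G) (n : nat) : seq G :=
  if n is n'.+1 then
    undup (ball S n' ++
           [seq x * y | x <- ball S n', y <- S ++ [seq s^-1 | s <- S]])
  else [:: 1].

Definition generates G (S : seq G) : Prop :=
  gen [set` S] =i predT.

(** Asking the bound for one or for every finite generating set is the same. *)
Definition exponential_growth (R : realType) G : Prop :=
  (exists S : seq G, generates S) /\
  (forall S : seq G, generates S ->
     exists2 c : R, (1 < c)%R &
       forall n : nat, (c ^+ n <= (size (ball S n))%:R)%R).

End GroupProperties.

(** * Interval exchange transformations *)

Section IET.
Variable R : realType.
Local Open Scope ring_scope.

Definition unit_Ico : Type := {x : R | 0 <= x < 1}.

Let pt (x : R) (x01 : 0 <= x < 1) : unit_Ico := exist _ x x01.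

Definition is_iet (f : unit_Ico -> unit_Ico) : Prop :=
  bijective f /\
  exists (I : finType) (a b c : I -> R),
    [/\ forall k, [/\ 0 <= a k, a k < b k & b k <= 1],
        forall x : unit_Ico, exists! k, a k <= val x < b k
      & forall k (x : unit_Ico), a k <= val x < b k -> val (f x) = val x + c k].

Record iet : Type := Iet { iet_fun :> unit_Ico -> unit_Ico; ietP : is_iet iet_fun }.

HB.instance Definition _ := gen_eqMixin iet.
HB.instance Definition _ := gen_choiceMixin iet.

Lemma iet_ext (f g : iet) : f =1 g -> f = g.
Proof.
case: f g => [f fP] [g gP] /= /funext fg; move: gP; rewrite -fg => gP.
by congr Iet; apply: Prop_irrelevance.
Qed.

(** Same as [is_iet], but with possibly empty intervals. *)
Lemma is_iet_weak f : bijective f ->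
  (exists (I : finType) (a b c : I -> R),
    [/\ forall k, a k < b k -> 0 <= a k /\ b k <= 1,
        forall x : unit_Ico, exists! k, a k <= val x < b k
      & forall k (x : unit_Ico), a k <= val x < b k -> val (f x) = val x + c k]) ->
  is_iet f.
Proof.
move=> bf [I [a [b [c [ab part tr]]]]]; split=> //.
exists {k : I | a k < b k}, (a \o val), (b \o val), (c \o val); split=> /=.
- by move=> [k /= kab]; have [] := ab k kab.
- move=> x; have [k [kx ku]] := part x.
  have kab : a k < b k by case/andP: kx => /le_lt_trans; apply.
  exists (exist _ k kab); split=> // j jx; apply: val_inj => /=.
  exact: ku.
- by move=> k x; apply: tr.
Qed.

Fact is_iet_id : is_iet id.
Proof.
split; first by exists id.
exists unit, (fun=> 0), (fun=> 1), (fun=> 0); split=> [_||_ x _].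
- by split.
- by move=> x; exists tt; split; [exact: (valP x) | case].
- by rewrite addr0.
Qed.

Fact is_iet_comp f g : is_iet f -> is_iet g -> is_iet (g \o f).
Proof.
move=> [bf [I [a [b [c [ab pf tf]]]]]] [bg [J [a' [b' [c' [ab' pg tg]]]]]].
apply: is_iet_weak; first exact: bij_comp.
exists (I * J)%type, (fun k => Num.max (a k.1) (a' k.2 - c k.1)),
  (fun k => Num.min (b k.1) (b' k.2 - c k.1)), (fun k => c k.1 + c' k.2).
have split_in (k : I * J) (x : unit_Ico) :
    Num.max (a k.1) (a' k.2 - c k.1) <= val x < Num.min (b k.1) (b' k.2 - c k.1) =
    (a k.1 <= val x < b k.1) && (a' k.2 <= val x + c k.1 < b' k.2).
  by rewrite ge_max lt_min lerBlDr ltrBrDr andbACA.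
split=> /=.
- move=> [i j] /= _; have [a0 _ b1] := ab i.
  by rewrite le_max a0 ge_min b1.
- move=> x; have [i [ix iu]] := pf x; have [j [jx ju]] := pg (f x).
  exists (i, j); split.
    by rewrite (split_in (i, j)) /= ix -(tf _ _ ix).
  move=> [i' j']; rewrite (split_in (i', j')) /= => /andP[/[dup] /iu <- _].
  by rewrite -(tf _ _ ix) => /ju <-.
- move=> [i j] x; rewrite split_in /= => /andP[ix].
  by rewrite -(tf _ _ ix) => /tg ->; rewrite (tf _ _ ix) addrA.
Qed.

Fact is_iet_inv f g : cancel f g -> cancel g f -> is_iet f -> is_iet g.
Proof.
move=> fK gK [bf [I [a [b [c [ab pf tf]]]]]]; split; first by exists f.
have bound k : 0 <= a k + c k /\ b k + c k <= 1.
  have [a0 lab b1] := ab k.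
  have ain : 0 <= a k < 1 by rewrite a0 (lt_le_trans lab).
  have := tf k (pt ain); rewrite /= lexx lab => /(_ isT) ack.
  split; first by rewrite -ack; case/andP: (valP (f (pt ain))).
  rewrite leNgt; apply/negP => bc1.
  pose y := Num.max (a k) (1 - c k).
  have yab : a k <= y < b k.
    by rewrite /y le_max lexx gt_max lab /= ltrBlDr.
  have y01 : 0 <= y < 1.
    by case/andP: yab => ay yb; rewrite (le_trans a0 ay) (lt_le_trans yb b1).
  have yc := tf k (pt y01) yab.
  have : y + c k < 1 by rewrite -yc; case/andP: (valP (f (pt y01))).
  by rewrite -ltrBrDr /y gt_max ltxx andbF.
have in_f k (y : unit_Ico) :
    (a k + c k <= val y < b k + c k) = (a k <= val (g y) < b k).
  apply/idP/idP => [kab|kab]; last first.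
    by have := tf k (g y) kab; rewrite gK => ->; rewrite lerD2r ltrD2r.
  have [a0 lab b1] := ab k.
  have yab : a k <= val y - c k < b k by rewrite lerBrDr ltrBlDr.
  have y01 : 0 <= val y - c k < 1.
    by case/andP: yab => ay yb; rewrite (le_trans a0 ay) (lt_le_trans yb b1).
  have fy : f (pt y01) = y.
    by apply: val_inj; rewrite /= (tf k (pt y01) yab) /= subrK.
  by rewrite -fy fK.
exists I, (fun k => a k + c k), (fun k => b k + c k), (fun k => - c k); split.
- by move=> k; have [] := bound k; have [] := ab k; split=> //; rewrite ltrD2r.
- move=> y; have [k [kx ku]] := pf (g y).
  by exists k; split; [rewrite in_f | move=> j; rewrite in_f; exact: ku].
- move=> k y; rewrite in_f => kab.
  by have := tf k _ kab; rewrite gK => ->; rewrite addrK.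
Qed.

Lemma iet_inv_ex (f : iet) : exists g, cancel f g /\ cancel g f.
Proof. by have [[g fK gK] _] := ietP f; exists g. Qed.

Let iet_invf (f : iet) := sval (cid (iet_inv_ex f)).
Let iet_invK (f : iet) : cancel f (iet_invf f) /\ cancel (iet_invf f) f.
Proof. exact: svalP (cid (iet_inv_ex f)). Qed.

Definition iet_one : iet := Iet is_iet_id.
Definition iet_inv (f : iet) : iet :=
  Iet (is_iet_inv (iet_invK f).1 (iet_invK f).2 (ietP f)).
(** First [f], then [g]: the convention of the library for permutations, so
    that [tau |-> E tau] below is a morphism. *)
Definition iet_mul (f g : iet) : iet := Iet (is_iet_comp (ietP f) (ietP g)).

Fact iet_mulA : associative iet_mul. Proof. by move=> *; apply: iet_ext. Qed.
Fact iet_mul1 : left_id iet_one iet_mul. Proof. by move=> *; apply: iet_ext. Qed.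
Fact iet_mulr1 : right_id iet_one iet_mul. Proof. by move=> *; apply: iet_ext. Qed.
Fact iet_mulV : left_inverse iet_one iet_inv iet_mul.
Proof. by move=> f; apply: iet_ext => x; exact: (iet_invK f).2. Qed.
Fact iet_mulrV : right_inverse iet_one iet_inv iet_mul.
Proof. by move=> f; apply: iet_ext => x; exact: (iet_invK f).1. Qed.

HB.instance Definition _ :=
  isGroup.Build iet iet_mulA iet_mul1 iet_mulr1 iet_mulV iet_mulrV.

(** ** Rotations; a real [a] stands for its class modulo 1 *)

Fact rot_subproof (a : R) (x : unit_Ico) :
  0 <= (val x + a) - (Num.floor (val x + a))%:~R < 1.
Proof.
have /andP[fl fg] := floor_itv (val x + a).
by rewrite subr_ge0 fl /= ltrBlDl -[ltRHS]addrC -[1]/(1%:~R) addrC -intrD.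
Qed.

Definition rot_fun (a : R) (x : unit_Ico) : unit_Ico := pt (rot_subproof a x).

Lemma rot_funE a x (m : int) :
  0 <= val x + a - m%:~R < 1 -> val (rot_fun a x) = val x + a - m%:~R.
Proof.
move=> /andP[m0 m1] /=; congr (_ - _%:~R); apply: floor_def.
by rewrite -subr_ge0 m0 intrD -ltrBlDl.
Qed.

Lemma rot_funK a : cancel (rot_fun a) (rot_fun (- a)).
Proof.
move=> x; apply: val_inj; rewrite (@rot_funE _ _ (- Num.floor (val x + a))) /=.
  by rewrite mulrNz opprK addrAC subrK addrK.
by rewrite mulrNz opprK addrAC subrK addrK (valP x).
Qed.

Fact is_iet_rot a : is_iet (rot_fun a).
Proof.
apply: is_iet_weak.
  exists (rot_fun (- a)); first exact: rot_funK.
  by rewrite -[X in cancel _ (rot_fun X)]opprK; apply: rot_funK.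
pose m := Num.floor a; pose t := a - m%:~R.
have t0 : 0 <= t by rewrite subr_ge0 floor_le.
have t1 : t < 1 by have := floorD1_gt a; rewrite intrD ltrBlDl.
exists bool, (fun k => if k then 1 - t else 0), (fun k => if k then 1 else 1 - t),
  (fun k => if k then t - 1 else t).
have xt (x : R) : x + a - m%:~R = x + t by rewrite /t addrA.
split.
- by case=> _; split; lra.
- move=> x; have /andP[x0 x1] := valP x.
  have [xl|xr] := ltP (val x) (1 - t).
  + exists false; split; first by rewrite x0 xl.
    by case=> // /andP[/le_lt_trans/(_ xl)]; rewrite ltxx.
  + exists true; split; first by rewrite xr x1.
    by case=> // /andP[_ /lt_le_trans/(_ xr)]; rewrite ltxx.
- move=> [] x /andP[xl xr]; have /andP[x0 x1] := valP x.
  + rewrite (@rot_funE _ _ (m + 1)); rewrite intrD; move: (xt (val x)); lra.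
  + by rewrite (@rot_funE _ _ m) xt; lra.
Qed.

Definition rotation (a : R) : iet := Iet (is_iet_rot a).

(** ** The iets [E tau]; the piece of index [i : 'I_q], counted from 0, is
    the interval from [i / q] to [(i + 1) / q] *)

Section Pieces.
Variable q : nat.
Implicit Types (i j : 'I_q) (tau rho : 'S_q).

Definition in_piece (i : 'I_q) (x : R) : bool :=
  i%:R / q%:R <= x < i.+1%:R / q%:R.

Definition E_val (tau : 'S_q) (x : R) : R :=
  if [pick i | in_piece i x] is Some i then x + ((tau i)%:R - i%:R) / q%:R else x.

Lemma in_piece_eq i j x : in_piece i x -> in_piece j x -> i = j.
Proof.
have q0 : 0 < q%:R :> R by rewrite ltr0n; case: i => i; case: q.
rewrite /in_piece !ler_pdivrMr // !ltr_pdivlMr // => /andP[i1 i2] /andP[j1 j2].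
have lt_ij : (i < j.+1)%N by rewrite -(ltr_nat R) (le_lt_trans i1 j2).
have lt_ji : (j < i.+1)%N by rewrite -(ltr_nat R) (le_lt_trans j1 i2).
by apply/val_inj/eqP; rewrite eqn_leq -ltnS lt_ij -ltnS.
Qed.

Lemma E_valE tau i x : in_piece i x -> E_val tau x = x + ((tau i)%:R - i%:R) / q%:R.
Proof.
rewrite /E_val; case: pickP => [j jx ix|/(_ i) ->//].
by rewrite (in_piece_eq ix jx).
Qed.

Lemma in_piece_E tau i x : in_piece i x -> in_piece (tau i) (E_val tau x).
Proof.
move=> ix; rewrite (E_valE _ ix) /in_piece.
have q0 : 0 < q%:R :> R by rewrite ltr0n; case: i {ix} => i; case: q.
move: ix; rewrite /in_piece => /andP[ix xi].
rewrite mulrBl addrA -!natr1 !mulrDl; move: ix xi; rewrite -natr1 mulrDl.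
by move=> ? ?; apply/andP; split; lra.
Qed.

Lemma piece_ex (x : unit_Ico) : (0 < q)%N -> exists i, in_piece i (val x).
Proof.
move=> q0; have q0R : 0 < q%:R :> R by rewrite ltr0n.
have /andP[x0 x1] := valP x.
have qx0 : 0 <= val x * q%:R by rewrite mulr_ge0 // ltW.
have /andP[n1 n2] := truncn_itv qx0.
have nq : (Num.truncn (val x * q%:R) < q)%N.
  by rewrite -(ltr_nat R) (le_lt_trans n1) // gtr_pMl.
by exists (Ordinal nq); rewrite /in_piece /= ler_pdivrMr // ltr_pdivlMr // n1 n2.
Qed.

Lemma piece_sub01 i x : in_piece i x -> 0 <= x < 1.
Proof.
have q0 : 0 < q%:R :> R by rewrite ltr0n; case: i => i; case: q.
move=> /andP[ix xi]; rewrite (le_trans _ ix) ?divr_ge0 ?ler0n //=.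
by rewrite (lt_le_trans xi) // ler_pdivrMr // mul1r ler_nat.
Qed.

Lemma E_val0 tau x : q = 0 -> E_val tau x = x.
Proof.
move=> q0; rewrite /E_val; case: pickP => // i _.
by have := ltn_ord i; rewrite [X in (_ < X)%N]q0.
Qed.

Fact E_subproof (tau : 'S_q) (x : unit_Ico) : 0 <= E_val tau (val x) < 1.
Proof.
have [q0|q0] := posnP q.
  by rewrite E_val0 // (valP x).
have [i ix] := piece_ex x q0; exact: piece_sub01 (in_piece_E tau ix).
Qed.

Definition E_fun (tau : 'S_q) (x : unit_Ico) : unit_Ico :=
  pt (E_subproof tau x).

Lemma E_fun1 : E_fun 1%g =1 id.
Proof.
move=> x; apply: val_inj; rewrite /= /E_val; case: pickP => // i _.
by rewrite perm1 subrr mul0r addr0.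
Qed.

Lemma E_funM tau rho x : E_fun (tau * rho)%g x = E_fun rho (E_fun tau x).
Proof.
apply: val_inj => /=; have [q0|q0] := posnP q.
  by rewrite !E_val0.
have [i ix] := piece_ex x q0.
rewrite (E_valE rho (in_piece_E tau ix)) !(E_valE _ ix) permM -addrA -mulrDl.
by rewrite [(tau i)%:R - _ + _]addrC subrKA.
Qed.

Fact is_iet_E tau : is_iet (E_fun tau).
Proof.
have bE : bijective (E_fun tau).
  exists (E_fun tau^-1%g) => x; rewrite -E_funM ?mulgV ?mulVg; exact: E_fun1.
have [q0|q0] := posnP q.
  have -> : E_fun tau = id; last exact: is_iet_id.
  apply: funext => x; apply: val_inj.
  by rewrite /= E_val0.
apply: is_iet_weak => //.
exists 'I_q, (fun i => i%:R / q%:R), (fun i => i.+1%:R / q%:R),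
  (fun i => ((tau i)%:R - i%:R) / q%:R); split.
- move=> i _; split; first by rewrite divr_ge0.
  by rewrite ler_pdivrMr ?ltr0n // mul1r ler_nat.
- move=> x; have [i ix] := piece_ex x q0.
  by exists i; split=> // j jx; apply: in_piece_eq ix jx.
- by move=> i x ix; apply: E_valE.
Qed.

Definition E (tau : 'S_q) : iet := Iet (is_iet_E tau).

Definition G_inv_q : set iet := range E.

(** The image of [Q] under [E tau |-> tau], for [Q] inside [G_inv_q]. *)
Definition symb (Q : {pred iet}) : {set 'S_q} := [set tau | E tau \in Q].

Definition sigma : 'S_q := perm (@ordS_inj q).

(** The finite group generated by the image of [Q] and by [sigma]. *)
Definition symb_sigma (Q : {pred iet}) : {group 'S_q} :=
  <<symb Q :|: [set sigma]>>%G.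

End Pieces.

Definition Q_grp (m : nat) (g : 'I_m -> iet) : groupClosed iet := gen (range g).

Definition H_AQ (s m : nat) (alpha : 'I_s -> R) (g : 'I_m -> iet) : groupClosed iet :=
  gen (range (rotation \o alpha) `|` range g)%classic.

(** Independence over the rationals in the quotient of [R] by the integers. *)
Definition Q_independent (s : nat) (alpha : 'I_s -> R) : Prop :=
  forall n : 'I_s -> int,
    \sum_(i < s) alpha i *~ n i \is a Num.int -> forall i, n i = 0.

End IET.

Arguments G_inv_q {R} q.
Arguments symb_sigma {R} q Q.

(* Main.v *)
From HB Require Import structures.
Require Import Defs.
From mathcomp Require Import all_boot all_order all_algebra all_fingroup all_solvable.
From mathcomp Require Import lra zify.
From mathcomp Require Import boolp classical_sets functions cardinality reals.

Set Implicit Arguments.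
Unset Strict Implicit.
Unset Printing Implicit Defensive.

Import Order.TTheory GRing.Theory Num.Theory.

(** Let [w = 1 / q].  The circle [R / Z] covers [R / wZ] with fibres of [q]
    points, and every element of [H] respects this covering: it translates the
    base by some [d] and permutes the points of each fibre, [acts f x d u].
    If fibres are parametrised by real numbers [x], with the index shifted by
    [sigma] when [x] moves by [w] ([acts_shift]), a rotation acts by a translation
    with the trivial permutation, and [E u] by [u] over all [x] of [[0, w)].
    So [H] is a group of translations twisted by [P]-valued step functions, and
    everything is read off this local form.

    The translation part is a morphism onto an abelian group.  Its kernel
    consists of step functions with values in a finite symmetric group; finitely
    many of them are constant on the classes of a common finite partition, hence
    generate a finite group.  So the kernel is a directed union of finite groups
    and [H] is in [EG 2] ([EG2_H]).

    Derived series.  A commutator in [H] does not move the base, and its values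
    are in [P^`(1)], because modulo [P^`(1)] the value of an element of [H] is the
    same over all fibres ([H_acts]).  Inductively, [D^k(H)] has values in
    [P^`(k)] for [k > 0].  Conversely, since the multiples of an irrational
    number are dense modulo 1, [H] contains a rotation of angle close to [w], which
    acts nearly like [sigma] in the middle of the period; hence each element of
    [P^`(k)] is the value of some element of [D^k(H)], up to a small translation
    ([approx_derived]).  So [D^k(H)] and [P^`(k)] vanish together for [k > 0].

    Now let [P] contain the alternating group, [q >= 5].  As the centre of the
    alternating group is trivial, some [u] in the image of [Q] does not commute
    with [sigma]; then [E u] is not a rotation, and it is discontinuous over the
    fibre of [0] and only there.  If [a] is irrational, two words in [E u * R_a]
    and [R_a] with distinct first letters thus differ in their behaviour near [0],
    because the later letters meet [E u] away from its discontinuity: the two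
    elements generate a free semigroup, whence exponential growth.

    Two conjugates of [E u] by rotations of nearly equal angles differ only over
    a short interval, where their quotient has the value [[~ u, sigma] != 1].
    Conjugation by elements that act nearly like those of [P] and simplicity of
    the alternating group then give, for each even permutation and each
    short interval, an element of [H] with this value at the middle of the interval
    and acting trivially outside ([localizable_Alt]).  So [H] contains elements
    of arbitrarily many alternating groups with disjoint supports.
    Among enough of them, two are congruent modulo a given subgroup of finite
    index, whose derived groups then all take every even permutation as a value
    over some fibre: [H] is not virtually solvable.  And commuting copies of
    a noncommuting pair of matrices are linearly independent, so that a matrix
    group contains only finitely many of them: [H] is not linear. *)

(** * Groups given by generators *)

Section GroupPredicates.
Variable G : groupType.
Local Open Scope group_scope.

(** The closure conditions of [gen] quantify over bundled predicates; this turns a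
    propositional invariant into one of them. *)
Definition pred_grp (T : G -> Prop) (T1 : T 1)
    (TM : forall x y, T x -> T y -> T (x * y)) (TV : forall x, T x -> T x^-1) :
    groupClosed G :=
  let S : {pred G} := fun x => `[< T x >] in
  let S1 : 1 \in S := asboolT T1 in
  let SM : mulg_closed S := fun x y Sx Sy => asboolT (TM x y (asboolW Sx) (asboolW Sy)) in
  let SV : invg_closed S := fun x Sx => asboolT (TV x (asboolW Sx)) in
  HB.pack S (isMulClosed.Build G S SM) (isMul1Closed.Build G S S1)
    (isInvClosed.Build G S SV).

Lemma pred_grpE T T1 TM TV x : reflect (T x) (x \in @pred_grp T T1 TM TV).
Proof. exact: asboolP. Qed.

Lemma gen_ind (A : set G) (T : G -> Prop) :
    T 1 -> (forall x y, T x -> T y -> T (x * y)) ->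
    (forall x, T x -> T x^-1) -> (forall a, A a -> T a) ->
  forall x, x \in gen A -> T x.
Proof.
move=> T1 TM TV TA x /genP /(_ (pred_grp T1 TM TV)) Tx.
by apply/(pred_grpE T1 TM TV)/Tx => a Aa; apply/(pred_grpE T1 TM TV)/TA.
Qed.

Lemma mem_gen_set (A : set G) a : A a -> a \in gen A.
Proof. by move=> Aa; apply/genP => S; apply. Qed.

Lemma derived_sub_grp n : exists S : groupClosed G, @derived G n =i S.
Proof.
case: n => [|n]; last first.
  pose A := [set [~ x, y] | x in [set` @derived G n] & y in [set` @derived G n]]%classic.
  by exists (gen A : groupClosed G).
exists (@pred_grp (fun=> True) I (fun _ _ _ _ => I) (fun _ _ => I)) => x.
by rewrite inE; apply/esym/asboolP.
Qed.

Lemma derived1 n : 1 \in @derived G n.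
Proof. by have [S SE] := derived_sub_grp n; rewrite SE gpred1. Qed.

Lemma derivedM n x y :
  x \in @derived G n -> y \in @derived G n -> x * y \in @derived G n.
Proof. by have [S SE] := derived_sub_grp n; rewrite !SE => Sx Sy; apply: gpredM. Qed.

Lemma derivedR n x y :
  x \in @derived G n -> y \in @derived G n -> [~ x, y] \in @derived G n.+1.
Proof. by move=> Dx Dy; apply: mem_gen_set; exists x => //; exists y. Qed.

Lemma derived_ind n (T : G -> Prop) :
    T 1 -> (forall x y, T x -> T y -> T (x * y)) ->
    (forall x, T x -> T x^-1) ->
    (forall x y, x \in @derived G n -> y \in @derived G n -> T [~ x, y]) ->
  forall x, x \in @derived G n.+1 -> T x.
Proof.
by move=> T1 TM TV TR; apply: gen_ind => // _ [x Dx [y Dy <-]]; apply: TR.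
Qed.

Lemma trivial_subP (S : {pred G}) : 1 \in S ->
  trivial_sub S <-> forall x, x \in S -> x = 1.
Proof.
move=> S1; split=> [E x Sx|E]; first by have : [set` S]%classic x by []; rewrite E.
by apply/seteqP; split=> x /= => [/E|->].
Qed.

Lemma derived_triv n :
  trivial_sub (@derived G n) <-> forall x, x \in @derived G n -> x = 1.
Proof. exact/trivial_subP/derived1. Qed.

Lemma nilpotent_solvable : nilpotent_grp G -> solvable_grp G.
Proof.
move=> [n Ln]; exists n; apply/derived_triv => x.
have L1 : 1 \in @lower_central G n by case: n {Ln x} => // n; apply: gpred1.
move=> Dx; apply: (proj1 (trivial_subP L1) Ln) => {Ln L1}.
elim: n x Dx => // n IHn; apply: derived_ind => [|x y|x|x y Dx _].
- exact: gpred1.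
- exact: gpredM.
- by move=> ?; apply: gpredVr.
- by apply: mem_gen_set; exists x; [apply: IHn | exists y].
Qed.

End GroupPredicates.

Definition to_subgrp (G : groupType) (S : groupClosed G) x (Sx : x \in S) : subgrp S :=
  exist (fun x => x \in S) x Sx.

(** These hold by conversion; stated for rewriting, they keep unification from
    unfolding the group structures of nested subgroups. *)
Lemma val_subgrpM (G : groupType) (S : groupClosed G) (x y : subgrp S) :
  val (x * y)%g = (val x * val y)%g.
Proof. by []. Qed.

Lemma val_subgrpR (G : groupType) (S : groupClosed G) (x y : subgrp S) :
  val [~ x, y]%g = [~ val x, val y]%g.
Proof. by []. Qed.

Lemma virtually_mono (P P' : groupType -> Prop) G :
  (forall K, P K -> P' K) -> virtually P G -> virtually P' G.
Proof. by move=> PP' [S fS PS]; exists S => //; apply: PP'. Qed.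

Section FiniteDerived.
Local Open Scope group_scope.
Variables (gT : finGroupType) (P : {group gT}).

(** A finite set that contains 1 and is closed under products is a subgroup. *)
Lemma gen_set_ind (A : {set gT}) (T : gT -> Prop) :
    T 1 -> (forall x y, T x -> T y -> T (x * y)) -> (forall a, a \in A -> T a) ->
  forall x, x \in <<A>> -> T x.
Proof.
move=> T1 TM TA x; pose B := [set y | `[< T y >]].
have gB : group_set B.
  apply/group_setP; split=> [|y z]; first by rewrite !inE.
  by rewrite !inE => Ty Tz; apply: TM.
have /fintype.subsetP sub : <<A>> \subset B.
  by rewrite (gen_subG _ (Group gB)); apply/fintype.subsetP => a /TA; rewrite !inE.
by move=> /sub; rewrite !inE.
Qed.

Lemma derived_subgE n (x : [subg P]%type) :
  (x \in @derived [subg P]%type n) = (sgval x \in P^`(n)).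
Proof.
elim: n x => [|n IHn] x; first by rewrite derg0 (valP x).
apply/idP/idP.
  move: x; apply: (@derived_ind [subg P]%type n (fun x : [subg P]%type => sgval x \in P^`(n.+1))) => [|x y|x|x y] /=.
  - exact: group1.
  - exact: groupM.
  - by rewrite -groupV.
  - by rewrite !IHn dergSn => ? ?; apply: mem_commg.
rewrite dergSn.
move=> Dx; suff [z Dz zx] : exists2 z : [subg P]%type, z \in @derived [subg P]%type n.+1 & sgval z = sgval x.
  by rewrite (_ : x = z) //; apply: val_inj.
move: (sgval x) Dx; apply: gen_set_ind => [|_ _ [a Da <-] [b Db <-]|_ /imset2P[y z Dy Dz ->]].
- by exists 1; rewrite ?derived1.
- by exists (a * b); rewrite ?derivedM.
have Py : y \in P by apply: fintype.subsetP Dy; apply: der_sub.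
have Pz : z \in P by apply: fintype.subsetP Dz; apply: der_sub.
by exists [~ subg P y, subg P z]; rewrite ?derivedR ?IHn /= ?subgK.
Qed.

Lemma derived_subg_triv n : trivial_sub (@derived [subg P]%type n) <-> P^`(n) = 1.
Proof.
split=> [/derived_triv D|D].
  apply/trivgP/fintype.subsetP => x Dx; have Px : x \in P by apply: fintype.subsetP Dx; apply: der_sub.
  have x1 : Subg Px = 1 by apply: D; rewrite derived_subgE.
  by rewrite inE -[x]/(sgval (Subg Px)) x1.
apply/derived_triv => x; rewrite derived_subgE D => /set1P x1.
exact: val_inj.
Qed.

End FiniteDerived.

(** * Growth and elementary amenability *)

Section Growth.
Variable G : groupType.
Local Open Scope group_scope.
Implicit Types (S : seq G) (x y : G).

Lemma mem_ballS S n x :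
  (x \in ball S n.+1) =
  (x \in ball S n) || (x \in [seq y * s | y <- ball S n, s <- S ++ [seq s^-1 | s <- S]]).
Proof. by rewrite /= mem_undup mem_cat. Qed.

Lemma ballS S n x : x \in ball S n -> x \in ball S n.+1.
Proof. by rewrite mem_ballS => ->. Qed.

Lemma ball_le S m n x : m <= n -> x \in ball S m -> x \in ball S n.
Proof.
by move=> /subnKC<-; elim: (n - m)%N => [|k IH]; rewrite ?addn0 // addnS => /IH/ballS.
Qed.

Lemma ballM S m n x y :
  x \in ball S m -> y \in ball S n -> x * y \in ball S (m + n).
Proof.
move=> xB; elim: n y => [|n IHn] y; first by rewrite inE addn0 => /eqP->; rewrite mulg1.
rewrite addnS mem_ballS => /orP[/IHn/ballS //|/allpairsP[[z s] /= [zB sS ->]]].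
by rewrite mulgA mem_ballS; apply/orP; right; apply: allpairs_f => //; apply: IHn.
Qed.

Lemma ball_letter S s : s \in S ++ [seq s^-1 | s <- S] -> s \in ball S 1.
Proof.
move=> sS; rewrite mem_ballS; apply/orP; right.
by apply/allpairsP; exists (1, s); rewrite mul1g inE.
Qed.

Lemma ballV S n x : x \in ball S n -> x^-1 \in ball S n.
Proof.
elim: n x => [|n IHn] x; first by rewrite !inE => /eqP->; rewrite invg1.
rewrite {1}mem_ballS => /orP[/IHn/ballS //|/allpairsP[[z s] /= [zB sS ->]]].
rewrite invgM; apply: (@ballM _ 1); last exact: IHn.
apply: ball_letter; move: sS; rewrite !mem_cat => /orP[sS|/mapP[t tS ->]].
  by rewrite map_f ?orbT.
by rewrite invgK tS.
Qed.

Lemma ball_gen S x : x \in gen [set` S]%classic -> exists n, x \in ball S n.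
Proof.
move: x; apply: gen_ind => [|x y [m xB] [n yB]|x [n xB]|s sS].
- by exists 0; rewrite inE.
- by exists (m + n)%N; apply: ballM.
- by exists n; apply: ballV.
- by exists 1%N; apply: ball_letter; rewrite mem_cat sS.
Qed.

Lemma ball_prod S (I : Type) k (f : I -> G) (u : seq I) :
  (forall i, f i \in ball S k) -> \prod_(i <- u) f i \in ball S (size u * k).
Proof.
move=> fB; elim: u => [|i u IHu]; first by rewrite big_nil inE.
by rewrite big_cons /= mulSn; apply: ballM.
Qed.

Variable R : realType.

Lemma root_of_2 k : exists2 c : R, (1 < c)%R & (c ^+ k <= 2)%R.
Proof.
(* Bernoulli's inequality for [(1 - y) ^+ k], with [k * y <= 1 / 2]; then take
   [c] to be the inverse of [1 - y] *)
have N0 : (0 < (2 * k.+1)%:R :> R)%R by rewrite ltr0n.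
pose y : R := ((2 * k.+1)%:R^-1)%R.
have y0 : (0 < y)%R by rewrite invr_gt0.
have y1 : (y < 1)%R by rewrite invf_lt1 // ltr1n mulnS.
have bern n : (1 - n%:R * y <= (1 - y) ^+ n)%R.
  elim: n => [|n IHn]; first by rewrite mul0r subr0.
  rewrite exprS; apply: le_trans (ler_wpM2l _ IHn); last by lra.
  rewrite -natr1; have : (0 <= n%:R * y * y)%R by rewrite !mulr_ge0 // ltW.
  by lra.
exists ((1 - y)^-1)%R; first by rewrite invf_gt1; lra.
have ky : (k%:R * y <= 1 / 2)%R.
  rewrite /y -ler_pdivlMr ?invr_gt0 // invrK natrM -(@natr1 _ k).
  by have : (0 <= k%:R :> R)%R; [exact: ler0n | lra].
rewrite exprVn invf_ple ?posrE ?exprn_gt0 //; last by lra.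
by apply: le_trans (bern k); lra.
Qed.

(** The products of [m] factors taken from a free pair are [2 ^ m] distinct
    elements of a ball whose radius is linear in [m]. *)
Lemma free_semigroup_growth S :
  has_free_semigroup2 G -> generates S ->
  exists2 c : R, (1 < c)%R & forall n, (c ^+ n <= (size (ball S n))%:R)%R.
Proof.
move=> [a [b free]] genS; pose f (i : bool) := if i then a else b.
have [k fB] : exists k, forall i, f i \in ball S k.
  have [m aB] : exists n, a \in ball S n by apply: ball_gen; rewrite genS.
  have [n bB] : exists n, b \in ball S n by apply: ball_gen; rewrite genS.
  by exists (m + n)%N; case; [apply: ball_le aB | apply: ball_le bB]; lia.
have words n m : 0 < m -> (m * k <= n)%N -> (2 ^ m <= size (ball S n))%N.
  move=> m0 mkn; have <- : #|{: m.-tuple bool}| = (2 ^ m)%N by rewrite card_tuple card_bool.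
  rewrite cardE -(size_map (fun u : m.-tuple bool => \prod_(i <- u) f i)).
  apply: uniq_leq_size => [|_ /mapP[u _ ->]].
    rewrite map_inj_uniq ?enum_uniq // => u v uv; apply: val_inj.
    by apply: free uv; rewrite -size_eq0 size_tuple -lt0n.
  by apply: ball_le mkn _; rewrite -{2}(size_tuple u); apply: ball_prod.
have [s sS s1] : exists2 s, s \in S & s != 1.
  apply: contrapT => noS; have triv x : x = 1.
    have : x \in gen [set` S]%classic by rewrite genS.
    move: x; apply: gen_ind => [|x y -> ->|x ->|s sS] //; rewrite ?mulg1 ?invg1 //.
    by apply: contrapT => /eqP s1; apply: noS; exists s.
  by have := free [:: true] [:: false] isT isT; rewrite !big_seq1 (triv a) (triv b) => /(_ erefl).
have two n : 0 < n -> 2 <= size (ball S n).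
  move=> n0; have : uniq [:: 1; s] by rewrite /= inE eq_sym s1.
  move=> /(@uniq_leq_size _ [:: 1; s])-> // x; rewrite !inE => /orP[]/eqP->.
    by apply: (@ball_le _ 0) => //; rewrite inE.
  by apply: (ball_le n0); apply: ball_letter; rewrite mem_cat sS.
(* [n = m * k.+1 + r] with [r < k.+1] gives [n <= 2 * k.+1 * m] as soon as
   [m > 0]; the factor 2 pays for the remainder *)
have [c c1 c2] := root_of_2 (2 * k.+1); exists c => // -[|n]; first by rewrite expr0.
have c0 : (0 <= c)%R by apply: le_trans (ltW c1).
set m := (n.+1 %/ k.+1)%N; have nm := divn_eq n.+1 k.+1; rewrite -/m in nm.
have rk := ltn_pmod n.+1 (ltn0Sn k).
have [m0|m0] := posnP m.
  apply: (le_trans _ (y := 2%:R)%R); last by rewrite ler_nat two.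
  by apply: le_trans c2; apply: ler_weXn2l; [exact: ltW | lia].
apply: (le_trans (y := (2 ^ m)%:R)%R); last by rewrite ler_nat; apply: words => //; nia.
rewrite natrX; apply: (le_trans (y := c ^+ (2 * k.+1 * m))%R).
  by apply: ler_weXn2l; [exact: ltW | nia].
by rewrite exprM lerXn2r // nnegrE ?exprn_ge0.
Qed.

End Growth.

(** A generating list of [gen A] has to consist of elements of the subtype;
    [insub] turns the elements of [l] into such and drops those outside. *)
Lemma generates_subgrp (G : groupType) (A : set G) (l : seq G) :
    (forall a, A a -> a \in l) -> exists S : seq (subgrp (gen A)), generates S.
Proof.
move=> Al; exists (pmap insub l) => x; rewrite [RHS]inE.
pose S' := gen [set` (pmap insub l : seq (subgrp (gen A)))]%classic.
suff: exists2 y : subgrp (gen A), y \in S' & val y = val x.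
  by move=> [y yS /val_inj <-].
have := valP x; move: (val x); apply: gen_ind => [|_ _ [y yS <-] [z zS <-]|_ [y yS <-]|a Aa].
- by exists 1%g; rewrite ?gpred1.
- by exists (y * z)%g; rewrite ?gpredM.
- by exists (y^-1)%g; rewrite ?gpredVr //; apply: gmulfV.
- have aA : a \in gen A by apply: mem_gen_set.
  exists (Sub a aA) => //; apply: mem_gen_set => /=.
  by rewrite mem_pmap; apply/mapP; exists a; [exact: Al | rewrite insubT].
Qed.

Lemma EG_elementary_amenable n G : EG n G -> elementary_amenable G.
Proof.
elim: n G => [|n IHn] G /=; first by case; [apply: EA_finite | apply: EA_abelian].
case=> [[N [K [ext /IHn EN /IHn EK]]]|[I [F [dF EF]]]].
  exact: EA_extension ext EN EK.
by apply: EA_direct_union dF _ => i; apply: IHn.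
Qed.

(** [EG 1] consists of the groups built from [EG 0] by exactly one step: here a
    trivial direct union. *)
Lemma EG_abelian G : abelian_grp G -> EG 1 G.
Proof.
move=> abG; right; exists unit, (fun=> gen setT : groupClosed G); split.
  split=> [|_ _|x]; first exact: (inhabits tt).
    by exists tt; split.
  by exists tt; apply: mem_gen_set.
by move=> _; right => x y; apply: val_inj; apply: abG.
Qed.

(** A locally finite group is the directed union of its finitely generated
    subgroups. *)
Lemma EG_locally_finite (G : groupType) :
    (forall l : seq G, finite_grp (subgrp (gen [set` l]%classic))) -> EG 1 G.
Proof.
move=> fG; right; exists (seq G), (fun l => gen [set` l]%classic : groupClosed G).
split; last by move=> l; left; apply: fG.
split=> [|l l'|x].
- exact: (inhabits [::]).
- exists (l ++ l'); split=> x; move: x; apply: gen_ind; do ?by [exact: gpred1 | exact: gpredM | move=> ?; exact: gpredVr].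
    by move=> a al; apply: mem_gen_set; rewrite /= mem_cat al.
  by move=> a al; apply: mem_gen_set; rewrite /= mem_cat al orbT.
- by exists [:: x]; apply: mem_gen_set; rewrite /= inE.
Qed.

(** * Local form of an exchange along the fibres *)

Section Circle.
Variable R : realType.
Local Open Scope ring_scope.
Implicit Types (x y a : R) (f : iet R).

Fact circ_subproof x : 0 <= x - (Num.floor x)%:~R < 1.
Proof. by have := rot_subproof x (exist _ 0 (introT andP (conj (lexx 0) ltr01))); rewrite /= add0r. Qed.

(** The projection to [R / Z].  Working with arbitrary reals instead of their
    representatives in [[0, 1)] removes all case distinctions on carries. *)
Definition circ x : unit_Ico R := exist _ (x - (Num.floor x)%:~R) (circ_subproof x).

Lemma eq_circ x y (k : int) : x = y + k%:~R -> circ x = circ y.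
Proof.
move=> ->; apply: val_inj; rewrite /= floorDrz ?intr_int // intrKfloor.
by rewrite intrD; lra.
Qed.

Lemma circ_inj x y : circ x = circ y -> exists k : int, x = y + k%:~R.
Proof.
move=> /(congr1 val) /= E; exists (Num.floor x - Num.floor y).
by rewrite intrB; lra.
Qed.

Lemma circ_val (p : unit_Ico R) : circ (val p) = p.
Proof.
apply: val_inj; rewrite /= (_ : Num.floor _ = 0) ?subr0 //.
by apply: floor_def; rewrite add0r; apply: (valP p).
Qed.

Lemma rotation_circ a x : rotation a (circ x) = circ (x + a).
Proof.
rewrite -[LHS]circ_val /=.
by apply: (@eq_circ _ _ (- Num.floor x - Num.floor (x - (Num.floor x)%:~R + a))); rewrite intrD !mulrNz; lra.
Qed.

Lemma rotationD a b : rotation (a + b) = (rotation a * rotation b)%g.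
Proof.
apply: iet_ext => p; rewrite -(circ_val p).
by rewrite rotation_circ addrA -!rotation_circ.
Qed.

Lemma eq_rotation a b (k : int) : a = b + k%:~R -> rotation a = rotation b.
Proof.
move=> ab; apply: iet_ext => p; rewrite -(circ_val p) !rotation_circ.
by apply: (@eq_circ _ _ k); rewrite ab addrA.
Qed.

Lemma rotation0 : rotation 0 = 1%g :> iet R.
Proof. by apply: iet_ext => p; rewrite -(circ_val p) rotation_circ addr0. Qed.

Lemma rotationN a : rotation (- a) = (rotation a)^-1%g.
Proof. by apply/esym/mulg1_eq; rewrite -rotationD subrr rotation0. Qed.

Lemma rotation_eq1 a : rotation a = 1%g -> exists k : int, a = k%:~R.
Proof.
move=> /(congr1 (fun f : iet R => f (circ 0))); rewrite rotation_circ => /circ_inj[k].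
by rewrite !add0r; exists k.
Qed.

End Circle.

Section Action.
Variables (R : realType) (q : nat).
Hypothesis q_gt0 : (0 < q)%N.
Local Open Scope ring_scope.
Implicit Types (x y d e : R) (i j : 'I_q) (s t : 'S_q) (f g : iet R).

Local Notation w := (q%:R^-1 : R).
Local Notation sg := (sigma q).

(** The point of index [i] in the fibre over [x]. *)
Definition pos x (i : 'I_q) := circ (x + i%:R * w).

Let q0 : (0 : R) < q%:R. Proof. by rewrite ltr0n. Qed.
Let w0 : 0 < w. Proof. by rewrite invr_gt0. Qed.
Let wq : q%:R * w = 1. Proof. by rewrite divff // gt_eqF. Qed.

Lemma pos_inj x : injective (pos x).
Proof.
move=> i j /circ_inj[k] E; apply: val_inj.
have {}E : i%:R = j%:R + (k * q%:Z)%:~R :> R.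
  have kq : (k * q%:Z)%:~R * w = k%:~R by rewrite intrM -mulrA -pmulrn wq mulr1.
  by apply: (mulIf (lt0r_neq0 w0)); rewrite mulrDl kq; lra.
have : (i%:Z)%:~R = (j%:Z + k * q%:Z)%:~R :> R by rewrite intrD -!pmulrn.
move=> /intr_inj ijk; have iq := ltn_ord i; have jq := ltn_ord j.
clear E; have [k1|k1|k0] := ltgtP k 0; [nia|nia|].
by move: ijk; rewrite k0 mul0r addr0; case.
Qed.

Lemma pos_sigma x i : pos x (sg i) = pos (x + w) i.
Proof.
rewrite /pos permE /=; have [iq|iq] := ltnP i.+1 q.
  by rewrite modn_small // -natr1 mulrDl mul1r; congr circ; lra.
have -> : i.+1 = q by apply/eqP; rewrite eqn_leq iq ltn_ord.
rewrite modnn mul0r addr0; apply/esym/(@eq_circ _ _ _ 1).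
have : i.+1%:R * w = 1 by rewrite (_ : i.+1 = q) //; apply/eqP; rewrite eqn_leq iq ltn_ord.
by rewrite -natr1 mulrDl mul1r; lra.
Qed.

Lemma fibre_ex (p : unit_Ico R) : exists x i, 0 <= x < w /\ pos x i = p.
Proof.
have [i] := piece_ex p q_gt0; rewrite /in_piece -natr1 mulrDl mul1r => /andP[ip pi].
exists (val p - i%:R * w), i; split; first by apply/andP; split; lra.
by rewrite /pos subrK circ_val.
Qed.

(** [f] carries the fibre over [x] to the fibre over [x + d] through the
    permutation [s] of the indices.  Letting [x] and [d] be arbitrary reals
    makes rotations act with the trivial permutation everywhere; the price is
    that [sigma] measures the monodromy when [x] or [d] moves by [1 / q]. *)
Definition acts f x d s := forall i, f (pos x i) = pos (x + d) (s i).

Lemma actsM f g x d e s t :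
  acts f x d s -> acts g (x + d) e t -> acts (f * g)%g x (d + e) (s * t)%g.
Proof. by move=> fs gt i; rewrite -[LHS]/(g (f (pos x i))) fs gt permM addrA. Qed.

Lemma acts1 x : acts 1%g x 0 1%g.
Proof. by move=> i; rewrite perm1 addr0. Qed.

Lemma actsV f x d s : acts f x d s -> acts f^-1%g (x + d) (- d) s^-1%g.
Proof.
move=> fs i; apply: (bij_inj (ietP f).1).
rewrite addrK fs permKV.
by have := congr1 (fun h : iet R => h (pos (x + d) i)) (mulVg f).
Qed.

Lemma actsM0 f g x s t : acts f x 0 s -> acts g x 0 t -> acts (f * g)%g x 0 (s * t)%g.
Proof. by move=> fs gt; rewrite -(addr0 0); apply: actsM; rewrite // addr0. Qed.

Lemma actsVr f x d s : acts f (x - d) d s -> acts f^-1%g x (- d) s^-1%g.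
Proof. by move=> /actsV; rewrite subrK. Qed.

Lemma actsV0 f x s : acts f x 0 s -> acts f^-1%g x 0 s^-1%g.
Proof. by move=> fs; rewrite -oppr0; apply: actsVr; rewrite subr0. Qed.

Lemma actsR0 f g x s t :
  acts f x 0 s -> acts g x 0 t -> acts [~ f, g]%g x 0 [~ s, t]%g.
Proof. by move=> fs gt; do 3?[apply: actsM0 => //; first exact: actsV0]; apply: actsM0. Qed.

Lemma acts_rotation a x : acts (rotation a) x a 1%g.
Proof. by move=> i; rewrite perm1 rotation_circ /pos; congr circ; lra. Qed.

Lemma acts_E s x : 0 <= x < w -> acts (E R s) x 0 s.
Proof.
move=> /andP[x0 xw] i; rewrite addr0.
have inp : in_piece i (x + i%:R * w).
  by rewrite /in_piece -natr1 mulrDl mul1r; apply/andP; split; lra.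
rewrite -[LHS]circ_val /pos; congr circ => /=.
have x1 := piece_sub01 inp.
rewrite (_ : Num.floor _ = 0); last by apply: floor_def; rewrite add0r.
rewrite subr0 (E_valE _ inp); lra.
Qed.

Lemma acts_uniq f x d s t : acts f x d s -> acts f x d t -> s = t.
Proof. by move=> fs ft; apply/permP => i; apply: (@pos_inj (x + d)); rewrite -fs -ft. Qed.

(** The effect of the monodromy: [x] and [x + 1 / q] are the same fibre, with
    indices shifted by [sigma]. *)
Lemma acts_shift f x d s : acts f (x + w) d s <-> acts f x d (s ^ sg)%g.
Proof.
split=> fs i.
  have := fs ((sg^-1)%g i); rewrite -pos_sigma permKV => ->.
  by rewrite addrAC -pos_sigma !permM.
by rewrite -pos_sigma fs addrAC -pos_sigma !permM permK.
Qed.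

Lemma acts_shift_target f x d s : acts f x (d + w) s <-> acts f x d (s * sg)%g.
Proof. by split=> fs i; rewrite fs ?permM addrA ?pos_sigma. Qed.

(** Values are conjugated when [x] moves by a period, so that the invariance of [T]
    has to be checked and does not come from that of the fibres. *)
Lemma period_ind (T : R -> Prop) :
  (forall x, T x <-> T (x + w)) -> (forall x, 0 <= x < w -> T x) -> forall x, T x.
Proof.
move=> Tw T0 x.
have Tn n y : T y <-> T (y + n%:R * w).
  elim: n => [|n IHn]; first by rewrite mul0r addr0.
  by rewrite IHn Tw -natr1 mulrDl mul1r addrA.
have Tz (k : int) y : T y <-> T (y + k%:~R * w).
  case: k => n; first exact: Tn.
  by have := Tn n.+1 (y - n.+1%:R * w); rewrite subrK NegzE mulrNz mulNr => -[]; split.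
rewrite (Tz (- Num.floor (x * q%:R))); apply: T0.
have := circ_subproof (x * q%:R); rewrite mulrNz mulNr => /andP[l1 l2].
have xE : x = x * q%:R * w by rewrite -mulrA wq mulr1.
rewrite (_ : x - _ = (x * q%:R - (Num.floor (x * q%:R))%:~R) * w); last by rewrite mulrBl -xE.
apply/andP; split; first by rewrite mulr_ge0 // ltW.
by rewrite gtr_pMl.
Qed.

(** The fibres over one period already cover the circle. *)
Lemma eq_acts f g :
  (forall x, 0 <= x < w -> exists d s, acts f x d s /\ acts g x d s) -> f = g.
Proof.
move=> fg; apply: iet_ext => p; have [x [i [xw <-]]] := fibre_ex p.
by have [d [s [-> ->]]] := fg x xw.
Qed.

(** Translations of the fibres are determined modulo [1 / q]. *)
Lemma acts_same f x d e s t :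
  acts f x d s -> acts f x e t -> exists k : int, d = e + k%:~R * w.
Proof.
move=> fs ft; have := fs (Ordinal q_gt0); rewrite ft => /circ_inj[k] E.
set i := t _ in E; set j := s _ in E.
have kq : (k * q%:Z)%:~R * w = k%:~R by rewrite intrM -mulrA -pmulrn wq mulr1.
exists (i%:Z - j%:Z - k * q%:Z); rewrite !intrB !mulrBl kq -!pmulrn; lra.
Qed.

(** The translation of a fibre may be replaced by any other one in its class
    modulo [1 / q], at the expense of a power of [sigma]. *)
Lemma acts_addz f x d s (k : int) :
  acts f x d s -> exists t, acts f x (d + k%:~R * w) t.
Proof.
have pn n e t : acts f x e t -> exists u, acts f x (e + n%:R * w) u.
  elim: n e t => [|n IHn] e t ft; first by exists t; rewrite mul0r addr0.
  have /IHn[u] : acts f x (e + w) (t * sg^-1)%g by apply/acts_shift_target; rewrite mulgKV.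
  by rewrite -addrA -{1}[w]mul1r -mulrDl nat1r; exists u.
have mn n e t : acts f x e t -> exists u, acts f x (e - n%:R * w) u.
  elim: n e t => [|n IHn] e t ft; first by exists t; rewrite mul0r subr0.
  have /IHn[u] : acts f x (e - w) (t * sg)%g by apply/acts_shift_target; rewrite subrK.
  by rewrite -addrA -opprD -{1}[w]mul1r -mulrDl nat1r; exists u.
by case: k => n fs; [exact: pn fs | rewrite NegzE mulrNz mulNr; exact: mn fs].
Qed.

End Action.

(** * Density of the multiples of an irrational number *)

Section Density.
Variables (R : realType) (a : R).
Hypothesis a_irr : irrational a.
Local Open Scope ring_scope.

Lemma irrational_mulz (n k : int) : n%:~R * a = k%:~R -> n = 0.
Proof.
move=> nak; apply: contrapT => /eqP n0; apply: a_irr.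
have n0R : n%:~R != 0 :> R by rewrite intr_eq0.
exists (k%:~R / n%:~R) => //; rewrite fmorph_div/= !ratr_int -nak.
by rewrite mulrAC divff // mul1r.
Qed.

(** Dirichlet's pigeonhole: among [N + 1] fractional parts of multiples of [a], two
    are in the same interval of length [1 / N]. *)
Lemma irrational_multiples (e : R) : 0 < e ->
  exists n k : int, n%:~R * a + k%:~R != 0 /\ `|n%:~R * a + k%:~R| < e.
Proof.
move=> e0; pose N := (Num.truncn e^-1).+1.
have N0 : 0 < N%:R :> R by rewrite ltr0n.
have Ne : N%:R^-1 < e.
  by rewrite invf_plt ?posrE // /N truncnS_gt.
pose c (j : nat) := j%:R * a - (Num.floor (j%:R * a))%:~R.
have cP j : 0 <= c j < 1 by exact: circ_subproof.
have box j : (Num.truncn (c j * N%:R) < N)%N.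
  have /andP[c0 c1] := cP j; rewrite -(ltr_nat R).
  have cN : 0 <= c j * N%:R by rewrite mulr_ge0 // ltW.
  by have /andP[/le_lt_trans-> //] := truncn_itv cN; rewrite gtr_pMl.
have : ~ injective (fun j : 'I_N.+1 => Ordinal (box j)).
  by move=> /leq_card; rewrite !card_ord ltnn.
move=> ninj; have [i [j [ij]]] : exists i j : 'I_N.+1, (i < j)%N /\ Ordinal (box i) = Ordinal (box j).
  apply: contrapT => no; apply: ninj => i j eij.
  by apply/val_inj; case: (ltngtP i j) => // l; case: no; [exists i, j | exists j, i].
move=> /(congr1 val) /= cij; exists (j%:Z - i%:Z), (Num.floor (i%:R * a) - Num.floor (j%:R * a)).
set d := _ + _; have dE : d = c j - c i by rewrite /d /c !intrB -!pmulrn; lra.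
split.
  apply/eqP => d0; have : (j%:Z - i%:Z)%:~R * a = (Num.floor (j%:R * a) - Num.floor (i%:R * a))%:~R.
    by move: d0; rewrite /d !intrB; lra.
  by move=> /irrational_mulz; lia.
have cN k : 0 <= c k * N%:R by have /andP[? _] := cP k; rewrite mulr_ge0 // ltW.
have /andP[i1 i2] := truncn_itv (cN i); have /andP[j1 j2] := truncn_itv (cN j).
apply: lt_trans Ne; rewrite -[N%:R^-1]mul1r ltr_pdivlMr // -(gtr0_norm N0) -normrM dE.
move: i1 i2 j1 j2; rewrite cij -!natr1 => i1 i2 j1 j2.
by rewrite ltr_norml; apply/andP; split; lra.
Qed.

Lemma irrational_dense (t e : R) : 0 < e ->
  exists n k : int, `|n%:~R * a + k%:~R - t| < e.
Proof.
move=> /irrational_multiples[n [k []]]; set d := _ + _ => d0 de.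
(* a step shorter than [e] is repeated until it reaches [t] *)
pose l := Num.floor (t / d); exists (l * n), (l * k).
apply: le_lt_trans de; have /andP[l1 l2] := circ_subproof (t / d).
rewrite !intrM -mulrA -mulrDr -/d distrC.
have -> : t - l%:~R * d = (t / d - l%:~R) * d by rewrite mulrBl divfK.
by rewrite normrM ler_piMl // ger0_norm // ltW.
Qed.

End Density.

(** * The group generated by the rotations and by [Q] *)

Section Group.
Variables (R : realType) (s m q : nat) (alpha : 'I_s -> R) (g : 'I_m -> iet R).
Hypothesis g_in : forall j, G_inv_q q (g j).
Local Open Scope ring_scope.
Implicit Types (u v : 'S_q) (f h : iet R).

Local Notation sg := (sigma q).
Local Notation K := (H_AQ alpha g).
Local Notation P := (symb_sigma q (Q_grp g)).

Lemma EM u v : E R (u * v)%g = (E R u * E R v)%g.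
Proof. by apply: iet_ext => p; apply: E_funM. Qed.

Lemma E1 : E R (1%g : 'S_q) = 1%g.
Proof. by apply: iet_ext => p; apply: E_fun1. Qed.

Lemma EV u : E R u^-1%g = (E R u)^-1%g.
Proof. by apply/esym/mulg1_eq; rewrite -EM mulgV E1. Qed.

Lemma mem_symb u : (u \in symb q (Q_grp g)) = (E R u \in Q_grp g).
Proof. by rewrite inE. Qed.

Lemma Q_in f : f \in Q_grp g -> exists2 u, u \in symb q (Q_grp g) & f = E R u.
Proof.
move=> Qf; suff [u _ fu] : G_inv_q q f by exists u => //; rewrite mem_symb fu.
move: f Qf; apply: gen_ind => [|_ _ [u _ <-] [v _ <-]|_ [u _ <-]|_ [j _ <-]].
- by exists 1%g => //; apply: E1.
- by exists (u * v)%g => //; apply: EM.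
- by exists u^-1%g => //; apply: EV.
- exact: g_in.
Qed.

Lemma Q_sub_H f : f \in Q_grp g -> f \in K.
Proof.
move: f; apply: gen_ind => [|x y|x|_ [j _ <-]]; do ?[exact: gpred1 | exact: gpredM].
  by move=> ?; apply: gpredVr.
by apply: mem_gen_set; right; exists j.
Qed.

Lemma symb_H u : u \in symb q (Q_grp g) -> E R u \in K.
Proof. by rewrite mem_symb => /Q_sub_H. Qed.

Lemma symb_P u : u \in symb q (Q_grp g) -> u \in P.
Proof. by move=> Qu; apply: mem_gen; rewrite !inE -mem_symb Qu. Qed.

Lemma sigma_P : sg \in P.
Proof. by apply: mem_gen; rewrite !inE eqxx orbT. Qed.

Lemma rotation_H (k : 'I_s) (n l : int) : rotation (n%:~R * alpha k + l%:~R) \in K.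
Proof.
rewrite (@eq_rotation _ _ (n%:~R * alpha k) l) //.
have pos_case (j : nat) : rotation (j%:R * alpha k) \in K.
  elim: j => [|j IHj]; first by rewrite mul0r rotation0 gpred1.
  rewrite -natr1 mulrDl mul1r rotationD gpredM //.
  by apply: mem_gen_set; left; exists k.
by case: n => j; rewrite ?NegzE ?mulrNz ?mulNr ?rotationN ?gpredVr // -pmulrn.
Qed.

(** [Q], the subgroup generated by the [g j], already consists of maps [E u], so
    the generators [g j] may be replaced by all of [Q]. *)
Lemma H_ind (T : iet R -> Prop) :
    T 1%g -> (forall f h, T f -> T h -> T (f * h)%g) -> (forall f, T f -> T f^-1%g) ->
    (forall k, T (rotation (alpha k))) ->
    (forall u, u \in symb q (Q_grp g) -> T (E R u)) ->
  forall f, f \in K -> T f.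
Proof.
move=> T1 TM TV TR TE; apply: gen_ind => // _ [[k _ <-]|[j _ <-]] //=.
have gQ : g j \in Q_grp g by apply: mem_gen_set; exists j.
by have [u Qu ->] := Q_in gQ; apply: TE.
Qed.

End Group.

(** * Derived series *)

Section DerivedSeries.
Variables (R : realType) (s m q : nat) (alpha : 'I_s -> R) (g : 'I_m -> iet R).
Hypotheses (q_gt0 : (0 < q)%N) (g_in : forall j, G_inv_q q (g j)).
Local Open Scope ring_scope.
Implicit Types (x y d e a b : R) (u v : 'S_q) (f h : iet R).

Local Notation w := (q%:R^-1 : R).
Local Notation sg := (sigma q).
Local Notation K := (H_AQ alpha g).
Local Notation H := (subgrp (H_AQ alpha g)).
Local Notation P := (symb_sigma q (Q_grp g)).

Let w0 : 0 < w. Proof. by rewrite invr_gt0 ltr0n. Qed.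

Lemma acts_commg f h x d e u1 u2 u3 u4 :
    acts f (x - d) d u1 -> acts h (x - d - e) e u2 ->
    acts f (x - d - e) d u3 -> acts h (x - e) e u4 ->
  acts [~ f, h]%g x 0 (u1^-1 * (u2^-1 * (u3 * u4)))%g.
Proof.
move=> a1 a2 a3 a4; have -> : 0 = - d + (- e + (d + e)) by lra.
apply: actsM; first exact: actsVr.
apply: actsM; first exact: actsVr.
by apply: actsM => //; rewrite (_ : _ + d = x - e) //; lra.
Qed.

Local Notation cs := (coset (P^`(1))%G).

Let normP u : u \in P -> u \in ('N(P^`(1)))%g.
Proof. by apply: fintype.subsetP; apply: der_norm. Qed.

Let cs_comm u v : u \in P -> v \in P -> commute (cs u) (cs v).
Proof.
move=> Pu Pv; have /centsP cc := der_abelian 0 P.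
by apply: cc; apply: mem_quotient.
Qed.

Let cs_conj u v : u \in P -> v \in P -> cs (u ^ v)%g = cs u.
Proof.
by move=> Pu Pv; rewrite morphJ ?normP // conjgE cs_comm // mulKg.
Qed.

(** In the abelianisation of [P] the monodromy is invisible, so the permutation
    by which an element of [H] acts has the same class over all fibres. *)
Lemma H_acts f : f \in K -> exists d (c : coset_of P^`(1)),
  forall x, exists u, [/\ u \in P, cs u = c & acts f x d u].
Proof.
move: f; apply: (H_ind g_in).
- by exists 0, 1%g => x; exists 1%g; split; [exact: group1 | exact: morph1 | exact: acts1].
- move=> f h [d [c fd]] [e [c' he]]; exists (d + e), (c * c')%g => x.
  have [u [Pu <- fu]] := fd x; have [v [Pv <- hv]] := he (x + d).
  by exists (u * v)%g; split; [exact: groupM | rewrite morphM ?normP | exact: actsM].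
- move=> f [d [c fd]]; exists (- d), c^-1%g => x; have [u [Pu <- fu]] := fd (x - d).
  by exists u^-1%g; split; [rewrite groupV | rewrite morphV ?normP | exact: actsVr].
- move=> k; exists (alpha k), 1%g => x; exists 1%g.
  by split; [exact: group1 | exact: morph1 | exact: acts_rotation].
- move=> u /symb_P Pu; exists 0, (cs u); apply: (period_ind q_gt0) => x; last first.
    by move=> xw; exists u; split=> //; apply: acts_E.
  split=> [[v [Pv <- fv]]|[v [Pv <- fv]]].
    exists (v ^ sg^-1)%g; rewrite groupJ ?cs_conj ?groupV ?sigma_P //; split=> //.
    by apply/(acts_shift q_gt0); rewrite conjgKV.
  exists (v ^ sg)%g; rewrite groupJ ?cs_conj ?sigma_P //; split=> //.
  exact/(acts_shift q_gt0).
Qed.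

Lemma H_acts_all f x d u : f \in K -> acts f x d u ->
  forall y, exists v, acts f y d v.
Proof.
move=> /H_acts[e [c fe]] fu y; have [v [_ _ fv]] := fe x.
have [k ->] := acts_same q_gt0 fu fv; have [v' [_ _ fv']] := fe y.
exact: acts_addz fv'.
Qed.

Lemma derived_acts k (z : H) : z \in @derived H k.+1 ->
  forall x, exists u, u \in (P^`(k.+1))%g /\ acts (val z) x 0 u.
Proof.
have closure n : (forall z1 z2 : H, z1 \in @derived H n -> z2 \in @derived H n ->
    forall x, exists u, u \in (P^`(n.+1))%g /\ acts (val [~ z1, z2]%g) x 0 u) ->
  forall y : H, y \in @derived H n.+1 ->
    forall x, exists u, u \in (P^`(n.+1))%g /\ acts (val y) x 0 u.
  move=> comm; apply: derived_ind => // [x|z1 z2 Z1 Z2 x|z1 Z1 x].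
  - by exists 1%g; split; [exact: group1 | exact: acts1].
  - have [u [Du zu]] := Z1 x; have [v [Dv zv]] := Z2 x.
    by exists (u * v)%g; split; [exact: groupM | exact: actsM0].
  - have [u [Du zu]] := Z1 x.
    by exists u^-1%g; split; [rewrite groupV | exact: actsV0].
elim: k z => [|k IHk]; apply: closure => z1 z2 D1 D2 x.
  have [d [c f1]] := H_acts (valP z1); have [e [c' f2]] := H_acts (valP z2).
  have [u1 [P1 c1 a1]] := f1 (x - d); have [u2 [P2 c2 a2]] := f2 (x - d - e).
  have [u3 [P3 c3 a3]] := f1 (x - d - e); have [u4 [P4 c4 a4]] := f2 (x - e).
  exists (u1^-1 * (u2^-1 * (u3 * u4)))%g; split; last exact: acts_commg a1 a2 a3 a4.
  (* the four values come from different fibres, so this is a commutator only in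
     the quotient *)
  apply: coset_idr; first by rewrite normP // !(groupM, groupV).
  rewrite !morphM ?morphV; do ?by rewrite normP // ?groupM ?groupV.
  by rewrite /= c1 c2 c3 c4 -c3 -c4 cs_comm // !mulKg mulVg.
have [u [Du zu]] := IHk _ D1 x; have [v [Dv zv]] := IHk _ D2 x.
exists [~ u, v]%g; split; first by rewrite dergSn; apply: mem_commg.
exact: actsR0.
Qed.

(** [u] is the value of some element of [S] over all fibres away from the ends of the
    period, up to an arbitrarily small translation.  This is how [sigma] is
    visible in [H], which need not contain the rotation of angle [1 / q]. *)
Definition approx (S : {pred H}) u := forall e, 0 < e ->
  exists2 z : H, z \in S & exists2 d, `|d| < e &
    forall x, e < x < w - e -> acts (val z) x d u.

Lemma approx1 S : 1%g \in S -> approx S 1%g.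
Proof.
by move=> S1 e e0; exists 1%g => //; exists 0; rewrite ?normr0 // => x _; apply: acts1.
Qed.

(** Each factor is taken with half the tolerance, so that the first translation does
    not leave the domain of validity of the second factor. *)
Lemma approxM S S' S'' u v :
    (forall z z', z \in S -> z' \in S' -> (z * z')%g \in S'') ->
  approx S u -> approx S' v -> approx S'' (u * v)%g.
Proof.
move=> SS Su Sv e e0; have e2 : 0 < e / 2 by lra.
have [z Sz [d de zu]] := Su _ e2; have [z' Sz' [d' de' zv]] := Sv _ e2.
exists (z * z')%g; first exact: SS.
exists (d + d'); first by apply: le_lt_trans (ler_normD _ _) _; lra.
move: de de'; rewrite !ltr_norml => /andP[? ?] /andP[? ?] x /andP[? ?].
by apply: actsM; [apply: zu | apply: zv]; apply/andP; split; lra.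
Qed.

Lemma approxR S S' u v :
    (forall z z', z \in S -> z' \in S -> [~ z, z']%g \in S') ->
  approx S u -> approx S v -> approx S' [~ u, v]%g.
Proof.
move=> SS Su Sv e e0; have e3 : 0 < e / 3 by lra.
have [z Sz [d de zu]] := Su _ e3; have [z' Sz' [d' de' zv]] := Sv _ e3.
exists [~ z, z']%g; first exact: SS.
exists 0; first by rewrite normr0.
move: de de'; rewrite !ltr_norml => /andP[? ?] /andP[? ?] x /andP[? ?].
by apply: (@acts_commg _ _ x d d'); [apply: zu | apply: zv | apply: zu | apply: zv];
  apply/andP; split; lra.
Qed.

Lemma approx_group (S : {pred H}) (A : {set 'S_q}) :
    1%g \in S -> (forall z z', z \in S -> z' \in S -> (z * z')%g \in S) ->
    (forall u, u \in A -> approx S u) ->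
  forall u, u \in <<A>>%g -> approx S u.
Proof.
move=> S1 SM SA; apply: gen_set_ind => // [|u v]; first exact: approx1.
exact: approxM.
Qed.

Variable k0 : 'I_s.
Hypothesis irr0 : irrational (alpha k0).

Lemma approx_H u : u \in P -> approx predT u.
Proof.
apply: approx_group => // {}u; rewrite !inE => /orP[Eu|/eqP->] e e0.
  have Hu : E R u \in K by apply: symb_H; rewrite mem_symb.
  exists (to_subgrp Hu) => //; exists 0; first by rewrite normr0.
  by move=> x /andP[? ?]; apply: acts_E => //; apply/andP; split; lra.
(* a rotation of angle [w + d] acts like [sigma] followed by a translation by [d] *)
have [n [l nl]] := irrational_dense irr0 w e0.
exists (to_subgrp (rotation_H alpha g k0 n l)) => //; exists (n%:~R * alpha k0 + l%:~R - w) => // x _.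
rewrite -[sg]mul1g; apply/(acts_shift_target q_gt0); rewrite subrK.
exact: acts_rotation.
Qed.

Lemma approx_derived k u : u \in (P^`(k))%g -> approx (@derived H k) u.
Proof.
elim: k u => [|k IHk] u; first by rewrite derg0; apply: approx_H.
rewrite dergSn; apply: approx_group => [|z z'|_ /imset2P[v v' Dv Dv' ->]].
- exact: derived1.
- exact: derivedM.
- by apply: approxR (IHk _ Dv) (IHk _ Dv') => z z'; apply: derivedR.
Qed.

Lemma derived_H_triv k : trivial_sub (@derived H k.+1) <-> (P^`(k.+1) = 1)%g.
Proof.
split=> [/derived_triv D|D].
  apply/trivgP/fintype.subsetP => u /approx_derived Du.
  (* the identity cannot be a translation by [d] with [0 < |d| < 1 / q] *)
  have w4 : 0 < w / 4 by rewrite divr_gt0.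
  have [z /D -> [d dw zd]] := Du _ w4.
  have zu : acts (1%g : iet R) (w / 2) d u.
    by apply: zd; move: w0; generalize w => y y0; apply/andP; split; lra.
  have z1 := @acts1 R q (w / 2).
  have [n dE] := acts_same q_gt0 zu z1.
  have n0 : n = 0.
    move: dw; rewrite dE add0r normrM (gtr0_norm w0) mulrC ltr_pM2l // => n4.
    have : `|n%:~R| < 1 :> R by apply: lt_trans n4 _; lra.
    by rewrite -intr_norm ltrz1; lia.
  by rewrite dE n0 mul0r addr0 in zu; rewrite inE (acts_uniq q_gt0 zu z1).
apply/derived_triv => z /derived_acts zu; apply: val_inj.
apply: (eq_acts q_gt0) => x _; have [u [Du xu]] := zu x.
by move: Du; rewrite D => /set1P u1; exists 0, 1%g; split; [rewrite -u1 | exact: acts1].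
Qed.

Lemma p_solvable_H p : (1 <= p)%N -> (q, p) <> (1, 1)%N ->
  p_solvable p H <-> p_solvable p [subg P].
Proof.
case: p => // p _ qp1; have D n : trivial_sub (@derived H n.+1) <-> trivial_sub (@derived [subg P]%type n.+1).
  by rewrite derived_H_triv derived_subg_triv.
rewrite /p_solvable -!pred_Sn; case: p qp1 => [q1|p _].
  have q2 : (1 < q)%N by rewrite ltn_neqAle q_gt0 andbT; apply/eqP => qE; apply: q1; rewrite -qE.
  have nH : ~ trivial_sub (@derived H 0).
    move=> /derived_triv triv; pose z : H := to_subgrp (rotation_H alpha g k0 1 0).
    have /(congr1 val) /= := triv z isT.
    rewrite mul1r addr0 => /rotation_eq1[n an].
    by have := irrational_mulz irr0 (n := 1) (k := n); rewrite mul1r => /(_ an).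
  have nP : ~ trivial_sub (@derived [subg P]%type 0).
    move=> /derived_subg_triv; rewrite derg0 => P1.
    have := sigma_P q g; rewrite P1 => /set1P s1.
    have := congr1 (fun u : 'S_q => val (u (Ordinal q_gt0))) s1.
    by rewrite perm1 permE /= modn_small.
  by split=> -[/D].
by split=> -[/D D1 nD]; split=> // /D.
Qed.

End DerivedSeries.

(** * Elementary amenability *)

Lemma morph_one (G L : groupType) (p : G -> L) :
  {morph p : x y / (x * y)%g} -> p 1%g = 1%g.
Proof. by move=> pM; apply: (mulgI (p 1%g)); rewrite -pM !mulg1. Qed.

Lemma morph_inv (G L : groupType) (p : G -> L) :
  {morph p : x y / (x * y)%g} -> {morph p : x / x^-1%g}.
Proof. by move=> pM x; apply/esym/mulg1_eq; rewrite -pM mulgV (morph_one pM). Qed.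

Lemma extension_of_morphism (G L : groupType) (p : G -> L) :
    {morph p : x y / (x * y)%g} ->
  exists N K : groupClosed _, [/\ is_extension (subgrp N) G (subgrp K),
    forall x, x \in N <-> p x = 1%g & forall y, y \in K <-> exists x, p x = y].
Proof.
move=> pM; have p1 := morph_one pM; have pV := morph_inv pM.
have NM x y : p x = 1%g -> p y = 1%g -> p (x * y)%g = 1%g.
  by move=> xN yN; rewrite pM xN yN mulg1.
have NV x : p x = 1%g -> p x^-1%g = 1%g by move=> xN; rewrite pV xN invg1.
have KM x y : (exists z, p z = x) -> (exists z, p z = y) -> exists z, p z = (x * y)%g.
  by move=> [a <-] [b <-]; exists (a * b)%g.
have KV x : (exists z, p z = x) -> exists z, p z = x^-1%g.
  by move=> [a <-]; exists a^-1%g.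
pose N := pred_grp p1 NM NV; pose K := pred_grp (ex_intro (fun z => p z = 1%g) _ p1) KM KV.
have NP x : reflect (p x = 1%g) (x \in N) by apply: pred_grpE.
have KP y : reflect (exists x, p x = y) (y \in K) by apply: pred_grpE.
exists N, K; split; [|by move=> x; split=> /NP|by move=> y; split=> /KP].
have pK x : p x \in K by apply/KP; exists x.
pose p' x := to_subgrp (pK x).
have p'M : {morph p' : x y / (x * y)%g} by move=> x y; apply: val_inj; apply: pM.
pose q' : {multiplicative G -> subgrp K} := HB.pack p' (isMultiplicative.Build _ _ p' p'M).
exists (val : subgrp N -> G), q'.
split=> [||x]; first exact: val_inj.
  apply/seteqP; split=> // -[y Ky] _; have /KP[x px] := Ky.
  by exists x => //; apply: val_inj.
split=> [/(congr1 val) /= /NP Nx|[[y Ny] _ /= <-]]; first by exists (to_subgrp Nx).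
by apply: val_inj => /=; apply/NP.
Qed.

Lemma finite_injection (F : choiceType) (T : finType) (f : F -> T) :
  injective f -> finite_set [set: F]%classic.
Proof.
move=> f_inj; have [[z0 _]|no] := pselect (exists z : F, True); last first.
  by rewrite (_ : setT = set0) //; apply/seteqP; split=> z // _; apply: no; exists z.
pose f' t := xget z0 [set z | f z = t]%classic.
rewrite (_ : setT = f' @` setT)%classic; first exact/finite_image/finite_finset.
apply/seteqP; split=> // z _; exists (f z) => //; apply: f_inj.
exact: (xgetPex z0 (P := [set y | f y = f z]%classic) (ex_intro _ z erefl)).
Qed.

Section Amenable.
Variables (R : realType) (q : nat).
Hypotheses (q_gt0 : (0 < q)%N).
Local Open Scope ring_scope.
Implicit Types (x y d e a b : R) (u v : 'S_q) (f h : iet R).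

Local Notation w := (q%:R^-1 : R).

(** [cl] describes a partition of the base on whose classes the fibrewise action of [f]
    is constant. *)
Definition compatible (T : Type) (cl : R -> T) f := forall x y, cl x = cl y ->
  forall u, acts f x 0 u -> acts f y 0 u.

(** The class of [x] records the pieces of [f] that contain the points of the
    fibre over [x]: on each piece [f] is a translation. *)
Lemma iet_classes f : exists (T : finType) (cl : R -> T), compatible cl f.
Proof.
have [_ [I [a [b [c [_ part tr]]]]]] := ietP f.
have [idx idxP] : {idx : unit_Ico R -> I & forall p, a (idx p) <= val p < b (idx p)}.
  by apply: (choice (P := fun (p : unit_Ico R) k => a k <= val p < b k)) => p; have [k [kp _]] := part p; exists k.
have fE x (i : 'I_q) : f (pos x i) = circ (x + i%:R * w + c (idx (pos x i))).
  rewrite -[LHS]circ_val (tr _ _ (idxP _)) /=.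
  apply: (@eq_circ _ _ _ (- Num.floor (x + i%:R * w))); rewrite mulrNz; lra.
exists {ffun 'I_q -> I}, (fun x => [ffun i => idx (pos x i)]) => x y /ffunP xy u fu i.
have {xy} := xy i; rewrite !ffunE => xy.
have := fu i; rewrite !fE xy => /circ_inj[n E].
by apply: (@eq_circ _ _ _ n); lra.
Qed.

Lemma iet_classes_seq (l : seq (iet R)) :
  exists (T : finType) (cl : R -> T), forall f, f \in l -> compatible cl f.
Proof.
elim: l => [|f l [T [cl lcl]]]; first by exists unit, (fun=> tt).
have [T' [cl' fcl]] := iet_classes f.
exists (T' * T)%type, (fun x => (cl' x, cl x)) => h.
rewrite inE => /orP[/eqP->|hl] x y [xy' xy]; first exact: fcl.
exact: lcl.
Qed.

(** Finitely many exchanges that preserve every fibre act in finitely many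
    ways on the fibres, because they have finitely many breakpoints. *)
Lemma fibrewise_locally_finite (N : groupType) (toI : N -> iet R) (l : seq N) :
    {morph toI : x y / (x * y)%g} -> injective toI ->
    (forall z x, exists u : 'S_q, acts (toI z) x 0 u) ->
  finite_grp (subgrp (gen [set` l]%classic)).
Proof.
move=> toIM toI_inj fib; have [T [cl lcl]] := iet_classes_seq [seq toI z | z <- l].
have comp z : z \in gen [set` l]%classic -> compatible cl (toI z).
  move: z; apply: gen_ind => [|z z' zc zc'|z zc|z zl] x y xy u.
  - rewrite (morph_one toIM) => xu; rewrite (acts_uniq q_gt0 xu (@acts1 R q x)).
    exact: acts1.
  - have [v xv] := fib z x; have [v' xv'] := fib z' x.
    rewrite toIM => xu; rewrite (acts_uniq q_gt0 xu (actsM0 xv xv')).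
    by apply: actsM0; [exact: zc xv | exact: zc' xv'].
  - have [v xv] := fib z x; rewrite (morph_inv toIM) => xu.
    by rewrite (acts_uniq q_gt0 xu (actsV0 xv)); apply/actsV0/(zc _ _ xy).
  - by apply: (lcl (toI z)) => //; rewrite map_f.
(* an element is determined by its values on the finitely many classes *)
pose val_at (z : N) t := xget 1%g [set u : 'S_q | exists2 x, cl x = t & acts (toI z) x 0 u]%classic.
pose table (z : subgrp (gen [set` l]%classic)) : {ffun T -> 'S_q} := [ffun t => val_at (val z) t].
have tableP (z : subgrp (gen [set` l]%classic)) x : acts (toI (val z)) x 0 (table z (cl x)).
  have [u xu] := fib (val z) x; rewrite ffunE /val_at.
  by case: xgetP => [v _ [y yx yv]|/(_ u)[]]; [apply: comp yv => //; apply: valP | exists x].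
apply: (@finite_injection _ _ table) => z z' zz'; apply/val_inj/toI_inj/(eq_acts q_gt0) => x _.
by exists 0, (table z (cl x)); split=> //; rewrite zz'.
Qed.

Variables (s m : nat) (alpha : 'I_s -> R) (g : 'I_m -> iet R).
Hypothesis g_in : forall j, G_inv_q q (g j).
Local Notation H := (subgrp (H_AQ alpha g)).

(** The translation of the base is defined modulo [1 / q] only; multiplied by [q] it
    becomes a class modulo 1, recorded by a rotation. *)
Lemma EG2_H : EG 2 H.
Proof.
have [d dP] : {d : H -> R & forall z x, exists u : 'S_q, acts (val z) x (d z) u}.
  apply: (choice (P := fun (z : H) d => forall x, exists u : 'S_q, acts (val z) x d u)) => z; have [d [c zd]] := H_acts q_gt0 g_in (valP z).
  by exists d => x; have [u [_ _ zu]] := zd x; exists u.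
have d_uniq z e (u : 'S_q) : acts (val z) 0 e u -> rotation (q%:R * e) = rotation (q%:R * d z).
  have [v zv] := dP z 0; move=> /(acts_same q_gt0)/(_ zv)[n ->].
  apply: (@eq_rotation _ _ _ n); rewrite mulrDr; congr (_ + _).
  by rewrite mulrCA divff ?mulr1 // pnatr_eq0 -lt0n.
have pM : {morph (fun z => rotation (q%:R * d z)) : x y / (x * y)%g}.
  move=> z z' /=; rewrite -rotationD -mulrDr; apply/esym.
  have [u zu] := dP z 0; have [v zv] := dP z' (0 + d z).
  by apply: (d_uniq (z * z')%g _ (u * v)%g); apply: actsM.
have [N [K [ext NP KP]]] := extension_of_morphism pM.
left; exists (subgrp N), (subgrp K); split=> //; last first.
  apply: EG_abelian => -[f Kf] [h Kh]; apply: val_inj => /=.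
  have [x <-] := (KP f).1 Kf; have [y <-] := (KP h).1 Kh.
  by rewrite -!rotationD addrC.
have toM : {morph (fun z : subgrp N => val (val z)) : x y / (x * y)%g}.
  by move=> z z'; rewrite (val_subgrpM z z') (val_subgrpM (val z) (val z')).
apply: EG_locally_finite => l; apply: (fibrewise_locally_finite l toM).
  by move=> z z' /val_inj/val_inj.
move=> z x /=; have [u zu] := dP (val z) x.
have /rotation_eq1[n dn] := (NP _).1 (valP z).
have -> : 0 = d (val z) + (- n)%:~R * w.
  by rewrite mulrNz -dn mulNr mulrAC divff ?mul1r ?subrr // pnatr_eq0 -lt0n.
exact: acts_addz zu.
Qed.

End Amenable.

(** * A free semigroup *)

Section FreeSemigroup.
Variables (R : realType) (q : nat).
Hypotheses (q_gt0 : (0 < q)%N).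
Local Open Scope ring_scope.
Implicit Types (x y d e a : R) (b : seq bool) (u v : 'S_q) (f h : iet R).

Local Notation w := (q%:R^-1 : R).
Local Notation sg := (sigma q).

Let w0 : 0 < w. Proof. by rewrite invr_gt0 ltr0n. Qed.

Lemma pos_add x y z (i j : 'I_q) : pos x i = pos y j -> pos (x + z) i = pos (y + z) j.
Proof. by move=> /circ_inj[n E]; apply: (@eq_circ _ _ _ n); lra. Qed.

(** Rotations commute with the one of angle [1 / q], which is [E sigma]. *)
Lemma rotation_E_commute a u : E R u = rotation a -> commute u sg.
Proof.
move=> Eu; apply/permP => i; rewrite !permM; apply: (@pos_inj R q q_gt0 0).
have Eu0 : acts (E R u) 0 0 u by apply: acts_E => //; rewrite lexx.
have /(pos_add w) ai : pos (0 + a) i = pos 0 (u i).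
  by have := Eu0 i; rewrite addr0 Eu acts_rotation perm1.
have := Eu0 (sg i); rewrite addr0 => <-.
by rewrite Eu !(pos_sigma q_gt0) acts_rotation perm1 -ai addrAC.
Qed.

(** Left of [0] the value of [E u] is conjugated by the monodromy, so [0] is a
    discontinuity when [u] and [sigma] do not commute. *)
Lemma acts_E_left u x : - w <= x < 0 -> acts (E R u) x 0 (u ^ sg)%g.
Proof.
move=> /andP[? ?]; apply/(acts_shift q_gt0); apply: acts_E => //.
by apply/andP; split; lra.
Qed.

Lemma acts_E_all u x : exists v : 'S_q, acts (E R u) x 0 v.
Proof.
move: x; apply: (period_ind q_gt0) => x; last by exists u; apply: acts_E.
split=> -[v xv]; first by exists (v ^ sg^-1)%g; apply/(acts_shift q_gt0); rewrite conjgKV.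
by exists (v ^ sg)%g; apply/(acts_shift q_gt0).
Qed.

(** Inside each period [E u] acts by a constant permutation, a conjugate of [u]. *)
Lemma acts_E_locally u x : (forall n : int, x <> n%:~R * w) ->
  exists v : 'S_q, exists2 e, 0 < e & forall y, `|y - x| < e -> acts (E R u) y 0 v.
Proof.
move: x; apply: (period_ind q_gt0) => x; last first.
  move=> /andP[x0 xw] /(_ 0) /eqP; rewrite mul0r => xn0; have {xn0}x0 : 0 < x by rewrite lt_def xn0.
  exists u, (Num.min x (w - x)); first by rewrite lt_min x0 /=; lra.
  move=> y; rewrite lt_min !ltr_norml => /andP[/andP[? ?] /andP[? ?]].
  by apply: acts_E => //; apply/andP; split; lra.
have step (n : int) : (n + 1)%:~R * w = n%:~R * w + w by rewrite intrD mulrDl mul1r.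
split=> Hx xn.
  have [n E|v [e e0 ev]] := Hx; first by apply: (xn (n + 1)); rewrite step E.
  exists (v ^ sg^-1)%g, e => // y; rewrite opprD addrA => ye.
  have -> : y = y - w + w by lra.
  by apply/(acts_shift q_gt0); rewrite conjgKV; apply: ev; rewrite addrAC.
have [n E|v [e e0 ev]] := Hx; first by apply: (xn (n - 1)); have := step (n - 1); rewrite subrK; lra.
exists (v ^ sg)%g, e => // y ye.
by apply/(acts_shift q_gt0); apply: ev; rewrite (_ : _ - _ = y - x) //; lra.
Qed.

Variables (a : R) (u : 'S_q).
Hypotheses (a_irr : irrational a) (u_nc : ~ commute u sg).

Definition word (b : seq bool) : iet R :=
  (\prod_(i <- b) (if i then E R u * rotation a else rotation a))%g.

Lemma word_cons i b : word (i :: b) = ((if i then E R u * rotation a else rotation a) * word b)%g.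
Proof. by rewrite /word big_cons. Qed.

Lemma letter_acts (i : bool) x v : acts (E R u) x 0 v ->
  acts (if i then E R u * rotation a else rotation a)%g x a (if i then v else 1)%g.
Proof.
move=> uv; case: i; last exact: acts_rotation.
rewrite -[v]mulg1 -[a in acts _ x a _]add0r; apply: actsM => //; exact: acts_rotation.
Qed.

Lemma word_acts b x : exists v : 'S_q, acts (word b) x ((size b)%:R * a) v.
Proof.
elim: b x => [|i b IHb] x.
  by exists 1%g; rewrite /word big_nil mul0r; apply: acts1.
have [v uv] := acts_E_all u x; have [v' bv] := IHb (x + a).
exists ((if i then v else 1) * v')%g; rewrite word_cons /= -nat1r mulrDl mul1r.
by apply: actsM => //; apply: letter_acts.
Qed.

(** The letters of a word that starts at [j a], [j > 0], meet [E u] near multiples of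
    [a] that are not multiples of [1 / q], hence away from its discontinuities. *)
Lemma word_locally b (j : nat) : (0 < j)%N -> exists v : 'S_q, exists2 e, 0 < e &
  forall y, `|y - j%:R * a| < e -> acts (word b) y ((size b)%:R * a) v.
Proof.
elim: b j => [|i b IHb] j j0.
  exists 1%g, 1 => // y _; rewrite /word big_nil mul0r; exact: acts1.
have [|v [e e0 ev]] := @acts_E_locally u (j%:R * a).
  move=> n jn; suff : (q%:Z * j%:Z) = 0 by nia.
  apply: (irrational_mulz a_irr (k := n)).
  by rewrite intrM -!pmulrn -mulrA jn mulrCA divff ?mulr1 // pnatr_eq0 -lt0n.
have [v' [e' e0' ev']] := IHb j.+1 isT.
exists ((if i then v else 1) * v')%g, (Num.min e e'); first by rewrite lt_min e0.
move=> y; rewrite lt_min => /andP[ye ye']; rewrite word_cons /= -nat1r mulrDl mul1r.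
apply: actsM; first by apply: letter_acts; apply: ev.
by apply: ev'; rewrite -natr1 mulrDl mul1r opprD addrACA subrr addr0.
Qed.

Lemma word_true_false b b' : size b = size b' -> word (true :: b) <> word (false :: b').
Proof.
move=> sb; rewrite !word_cons => bb'.
have [v [e e0 ev]] := @word_locally b 1 isT; have [v' [e' e0' ev']] := @word_locally b' 1 isT.
(* to the left and to the right of [0], the first letter must have the same value,
   since the tails are locally constant there *)
have value x t : `|x| < Num.min e e' -> acts (E R u) x 0 t -> t = (v' * v^-1)%g.
  rewrite lt_min => /andP[xe xe'] xt.
  have xb : acts (word b) (x + a) ((size b)%:R * a) v by apply: ev; rewrite mul1r addrK.
  have xb' : acts (word b') (x + a) ((size b')%:R * a) v' by apply: ev'; rewrite mul1r addrK.
  have := actsM (letter_acts true xt) xb; rewrite bb' sb.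
  move=> /(acts_uniq q_gt0)/(_ (actsM (letter_acts false xt) xb')) /=.
  by rewrite mul1g => <-; rewrite mulgK.
pose x := - (Num.min (Num.min e e') w / 2).
have m0 : 0 < Num.min (Num.min e e') w by rewrite !lt_min e0 e0'.
have me : Num.min (Num.min e e') w <= Num.min e e' by rewrite ge_min lexx.
have mw : Num.min (Num.min e e') w <= w by rewrite ge_min lexx orbT.
have u0 : u = (v' * v^-1)%g.
  apply: (value 0); first by rewrite normr0; lra.
  by apply: acts_E => //; rewrite lexx.
have ux : (u ^ sg)%g = (v' * v^-1)%g.
  apply: (value x); first by rewrite normrN ger0_norm; lra.
  by apply: acts_E_left; apply/andP; split; rewrite /x; lra.
by apply: u_nc; rewrite /commute conjgC ux -u0.
Qed.

Lemma word_inj : injective word.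
Proof.
move=> b b' bb'.
have sb : size b = size b'.
  have [v bv] := word_acts b 0; have [v' bv'] := word_acts b' 0.
  rewrite bb' in bv; have [n E] := acts_same q_gt0 bv bv'.
  suff : q%:Z * ((size b)%:Z - (size b')%:Z) = 0 by nia.
  apply: (irrational_mulz a_irr (k := n)).
  rewrite intrM intrB -!pmulrn -mulrA mulrBl E addrAC subrr add0r.
  by rewrite mulrCA divff ?mulr1 // pnatr_eq0 -lt0n.
elim: b b' bb' sb => [|i b IHb] [|i' b'] // bb' [sb].
case: i i' bb' => -[] => [bb'|/word_true_false-/(_ sb) //|/esym/word_true_false-/(_ (esym sb)) //|bb'];
  by congr (_ :: _); apply: IHb => //; move: bb'; rewrite !word_cons => /mulgI.
Qed.

Variables (s m : nat) (alpha : 'I_s -> R) (g : 'I_m -> iet R).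
Local Notation K := (H_AQ alpha g).
Local Notation H := (subgrp (H_AQ alpha g)).

Lemma free_semigroup_H : E R u \in K -> rotation a \in K -> has_free_semigroup2 H.
Proof.
move=> Ku Ka; have Kua : (E R u * rotation a)%g \in K by apply: gpredM.
exists (to_subgrp Kua), (to_subgrp Ka) => b b' _ _.
have E c : val (\prod_(i <- c) (if i then to_subgrp Kua else to_subgrp Ka))%g = word c.
  elim: c => [|i c IHc]; first by rewrite /word !big_nil.
  by rewrite word_cons big_cons -IHc; case: i.
by move=> /(congr1 val); rewrite !E => /word_inj.
Qed.

End FreeSemigroup.

Section Alternating.
Variables (R : realType) (m q : nat) (g : 'I_m -> iet R).
Hypotheses (q5 : (5 <= q)%N).
Local Open Scope group_scope.

Local Notation sg := (sigma q).
Local Notation P := (symb_sigma q (Q_grp g)).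

Lemma Alt_normal_sub (N : {group 'S_q}) :
  N \subset 'Alt_('I_q) -> 'Alt_('I_q) \subset 'N(N) -> N :!=: 1 -> N :=: 'Alt_('I_q).
Proof.
move=> NA nN N1; have /simpleP[_ simA] : simple 'Alt_('I_q) by apply: simple_Alt5; rewrite card_ord.
by have [] := simA N; [rewrite /normal NA | move/eqP; rewrite (negPf N1) | ].
Qed.

Lemma Alt_not_solvable : solvable 'Alt_('I_q) = false.
Proof. by apply: solvable_AltF; rewrite card_ord. Qed.

Lemma Alt_not_abelian : ~~ abelian 'Alt_('I_q).
Proof. by apply/negP => /abelian_sol; rewrite Alt_not_solvable. Qed.

(** Otherwise [sigma] would be central in [P], and [sigma ^+ 2], which is even, would
    be a nontrivial central element of the alternating group. *)
Lemma symb_not_central : 'Alt_('I_q) \subset P ->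
  exists2 u, u \in symb q (Q_grp g) & ~ commute u sg.
Proof.
move=> AP; apply: contrapT => no.
have PC : P \subset 'C[sg].
  rewrite gen_subG; apply/fintype.subsetP => u; rewrite finset.in_setU => /orP[Qu|/set1P->]; last exact: cent1id.
  by apply/cent1P; apply: contrapT => nu; apply: no; exists u => // /esym.
have sA : sg ^+ 2 \in 'Alt_('I_q) by rewrite Alt_even expgS expg1 odd_permM addbb.
have sZ : sg ^+ 2 \in 'Z('Alt_('I_q)).
  rewrite inE sA; apply/centP => u /(fintype.subsetP AP)/(fintype.subsetP PC)/cent1P us.
  by apply: commute_sym; apply: commuteX.
have [Z1|Z1] := eqVneq 'Z('Alt_('I_q)) 1; last first.
  have ZA := @Alt_normal_sub 'Z('Alt_('I_q))%G (center_sub _) (normal_norm (center_normal _)) Z1.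
  by case/negP: Alt_not_abelian; apply/center_idP.
have q0 : 0 < q by apply: leq_trans q5.
move: sZ; rewrite Z1 => /set1P/(congr1 (fun u : 'S_q => val (u (Ordinal q0)))).
rewrite expgS expg1 permM perm1 !permE /= !modn_small //; exact: leq_trans q5.
Qed.

End Alternating.

(** * Copies of the alternating group with disjoint supports *)

Section Localized.
Variables (R : realType) (s m q : nat) (alpha : 'I_s -> R) (g : 'I_m -> iet R).
Hypotheses (q_gt0 : (0 < q)%N) (g_in : forall j, G_inv_q q (g j)).
Variable k0 : 'I_s.
Hypothesis irr0 : irrational (alpha k0).
Local Open Scope ring_scope.
Implicit Types (x y d e a b r : R) (u v : 'S_q) (f h : iet R).

Local Notation w := (q%:R^-1 : R).
Local Notation sg := (sigma q).
Local Notation K := (H_AQ alpha g).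
Local Notation H := (subgrp (H_AQ alpha g)).
Local Notation P := (symb_sigma q (Q_grp g)).
Local Notation Alt := ('Alt_('I_q))%g.

Let w0 : 0 < w. Proof. by rewrite invr_gt0 ltr0n. Qed.

Definition fibrewise f := forall x, exists u : 'S_q, acts f x 0 u.

(** The distance of [x] and [y] modulo [1 / q] is at least [r]. *)
Definition far x y r := forall k : int, r <= `|x + k%:~R * w - y|.

Lemma acts_conj f h x d u v : acts f (x - d) 0 u -> acts h (x - d) d v ->
  acts (f ^ h)%g x 0 (u ^ v)%g.
Proof.
move=> fu hv; have -> : 0 = - d + (0 + d) by lra.
by apply: actsM; [apply: actsVr | apply: actsM; rewrite // addr0].
Qed.

(** [u] occurs as the value over [y] of an element of [H] supported in an arbitrarily
    small neighbourhood.  Asking this for all [y] at once makes the property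
    invariant under conjugation by [P], which moves [y] slightly. *)
Definition localizable u := forall y r, 0 < y < w -> 0 < r -> exists2 f, f \in K &
  [/\ acts f y 0 u, fibrewise f & forall x, far x y r -> acts f x 0 (1%g : 'S_q)].

Lemma localizable1 : localizable 1%g.
Proof.
move=> y r _ _; exists 1%g; first exact: gpred1.
by split=> [|x|x _]; [|exists 1%g|]; apply: acts1.
Qed.

Lemma localizableM u v : localizable u -> localizable v -> localizable (u * v)%g.
Proof.
move=> lu lv y r yw r0; have [f Kf [fy ff fr]] := lu y r yw r0.
have [h Kh [hy fh hr]] := lv y r yw r0; exists (f * h)%g; first exact: gpredM.
split=> [|x|x xy]; first exact: actsM0.
  by have [t ft] := ff x; have [t' ht] := fh x; exists (t * t')%g; apply: actsM0.
by rewrite -[1%g]mulg1; apply: actsM0; [apply: fr | apply: hr].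
Qed.

(** Conjugation by an element of [H] that acts near [y] like [v], up to a small
    translation [d], moves the support by [d]. *)
Lemma localizableJ u v : v \in P -> localizable u -> localizable (u ^ v)%g.
Proof.
move=> Pv lu y r /andP[y0 yw] r0; pose e := Num.min y (w - y) / 2.
have m0 : 0 < Num.min y (w - y) by rewrite lt_min y0 subr_gt0.
have my : Num.min y (w - y) <= y by rewrite ge_min lexx.
have mw : Num.min y (w - y) <= w - y by rewrite ge_min lexx orbT.
have e0 : 0 < e by rewrite divr_gt0.
have eE : Num.min y (w - y) = e + e by rewrite /e; lra.
have [z _ [d de zv]] := approx_H q_gt0 irr0 Pv e0.
move: de; rewrite ltr_norml => /andP[d1 d2].
have [| f Kf [fy ff fr]] := lu (y - d) r _ r0; first by apply/andP; split; lra.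
have zy : acts (val z) (y - d) d v by apply: zv; apply/andP; split; lra.
have zall := H_acts_all q_gt0 g_in (valP z) zy.
exists (f ^ val z)%g; first by apply: gpredJ => //; apply: valP.
split=> [|x|x xy]; first exact: acts_conj fy zy.
  have [t ft] := ff (x - d); have [t' zt] := zall (x - d).
  by exists (t ^ t')%g; apply: acts_conj ft zt.
have [t' zt] := zall (x - d); rewrite -(conj1g t'); apply: acts_conj zt.
apply: fr => n; apply: le_trans (xy n) _; rewrite (_ : x + _ - y = x - d + n%:~R * w - (y - d)) //.
by lra.
Qed.

(** Conjugates of [E u] by two rotations of nearly equal angles [b < b'] differ
    only over the fibres between [b] and [b']. *)
Lemma localizableR u : u \in symb q (Q_grp g) -> localizable [~ u, sg]%g.
Proof.
move=> Qu y r _ r0; pose p := Num.min r (w / 2).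
have p0 : 0 < p by rewrite lt_min r0 divr_gt0.
have pr : p <= r by rewrite ge_min lexx.
have pw : p <= w / 2 by rewrite ge_min lexx orbT.
have w2 : w = w / 2 + w / 2 by rewrite -splitr.
have p2 : 0 < p / 2 by rewrite divr_gt0.
have pE : p = p / 2 + p / 2 by rewrite -splitr.
have [n [l]] := irrational_dense irr0 (y - p / 2) p2.
have [n' [l']] := irrational_dense irr0 (y + p / 2) p2.
have := rotation_H alpha g k0 n l; have := rotation_H alpha g k0 n' l'.
move: (_ + l%:~R) (_ + l'%:~R) => b b' Kb' Kb.
rewrite !ltr_norml => /andP[b1 b2] /andP[b3 b4].
have Ku := symb_H alpha Qu.
pose F c := (E R u ^ rotation c)%g.
have Fu c x v : acts (E R u) (x - c) 0 v -> acts (F c) x 0 v.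
  by move=> uv; rewrite -[v]conjg1; apply: (acts_conj (d := c)) => //; apply: acts_rotation.
have Fall c : fibrewise (F c).
  by move=> x; have [v uv] := acts_E_all q_gt0 u (x - c); exists v; apply: Fu.
exists ((F b)^-1 * F b')%g; first by rewrite gpredM ?gpredVr ?gpredJ.
have ub x : b <= x < b + w -> acts (F b) x 0 u.
  by move=> /andP[? ?]; apply/Fu/acts_E => //; apply/andP; split; lra.
have ub' x : b' <= x < b' + w -> acts (F b') x 0 u.
  by move=> /andP[? ?]; apply/Fu/acts_E => //; apply/andP; split; lra.
split=> [|x|].
- rewrite commgEl; apply: actsM0; first by apply/actsV0/ub; apply/andP; split; lra.
  by apply/Fu/(acts_E_left q_gt0); apply/andP; split; lra.
- have [t ft] := Fall b x; have [t' ft'] := Fall b' x.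
  by exists (t^-1 * t')%g; apply: actsM0 => //; apply: actsV0.
suff trivb x : far (x + b) y r -> acts ((F b)^-1 * F b')%g (x + b) 0 (1%g : 'S_q).
  by move=> x xy; rewrite -(subrK b x); apply: trivb; rewrite subrK.
move: x; apply: (period_ind q_gt0) => x; last first.
  move=> /andP[x0 xw] /(_ 0); rewrite mul0r addr0 => xy.
  have xb : b <= x + b < b + w by apply/andP; split; lra.
  have xb' : b' <= x + b.
    by rewrite leNgt; apply/negP => xb'; move: xy; rewrite leNgt ltr_norml => /negP[]; apply/andP; split; lra.
  rewrite -[1%g](mulVg u); apply: actsM0; first exact/actsV0/ub.
  by apply: ub'; rewrite xb' /=; lra.
rewrite addrAC acts_shift // conj1g; split=> Hx xy; apply: Hx => k.
  have := xy (k - 1); rewrite intrB mulrBl mul1r.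
  by rewrite (_ : x + b + w + _ - y = x + b + k%:~R * w - y) //; lra.
have := xy (k + 1); rewrite intrD mulrDl mul1r.
by rewrite (_ : x + b + _ - y = x + b + w + k%:~R * w - y) //; lra.
Qed.

Hypotheses (q5 : (5 <= q)%N) (AltP : (Alt \subset P)%g).

(** The localizable even permutations form a normal subgroup of the alternating
    group, which contains [[~ u, sigma]]. *)
Lemma localizable_Alt v : v \in Alt -> localizable v.
Proof.
have [u Qu u_nc] := symb_not_central q5 AltP.
pose B := [set v in Alt | `[< localizable v >]].
have BP v' : reflect (v' \in Alt /\ localizable v') (v' \in B).
  rewrite [v' \in B]finset.in_set; apply: (iffP andP) => -[Av]; last by move=> lv; split=> //; apply: asboolT.
  by move=> /asboolW lv.
have gB : group_set B.
  apply/group_setP; split=> [|x y]; first by apply/BP; split; [exact: group1 | exact: localizable1].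
  by move=> /BP[Ax lx] /BP[Ay ly]; apply/BP; split; [exact: groupM | exact: localizableM].
have BA : Group gB :=: Alt.
  apply: Alt_normal_sub => //=.
  - by apply/fintype.subsetP => x /BP[].
  - apply/fintype.subsetP => y Ay; rewrite inE; apply/fintype.subsetP => _ /imsetP[x /BP[Ax lx] ->].
    apply/BP; split; first exact: groupJ.
    by apply: localizableJ => //; apply: fintype.subsetP Ay.
  - apply/eqP => B1; have : [~ u, sg]%g \in B.
      apply/BP; split; last exact: localizableR.
      rewrite Alt_even commgEl conjgE !odd_permM !odd_permV.
      by case: (odd_perm u); case: (odd_perm sg).
    by rewrite B1 => /set1P/eqP/commgP.
by rewrite -BA => /BP[].
Qed.

Lemma far_points n : exists (y : 'I_n -> R) r, [/\ 0 < r, forall i, 0 < y i < w &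
  forall i j, i != j -> forall x, far x (y i) r \/ far x (y j) r].
Proof.
(* [n] points that are multiples of [w / n.+1] in the interior of the period, with
   disjoint neighbourhoods of radius half the step *)
pose c := w / n.+1%:R; have n0 : 0 < n.+1%:R :> R by rewrite ltr0n.
have c0 : 0 < c by rewrite divr_gt0.
have wc : w = n.+1%:R * c by rewrite /c mulrCA divff ?mulr1 // gt_eqF.
exists (fun i => i.+1%:R * c), (c / 2); split; first by rewrite divr_gt0.
  move=> i; rewrite mulr_gt0 // wc ltr_pM2r // ltr_nat ltnS ltn_ord //.
move=> i j ij x; apply: contrapT => /not_orP[/existsNP[k /negP] + /existsNP[l /negP]].
rewrite -!ltNge => ki lj.
have := le_lt_trans (ler_normB _ _) (ltrD ki lj); rewrite -splitr.
set e := _ - (_ - _); have -> : e = ((k - l) * n.+1%:Z + (j%:Z - i%:Z))%:~R * c.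
  rewrite /e wc intrD intrM !intrB -!pmulrn -!natr1; lra.
rewrite normrM (gtr0_norm c0) gtr_pMl // -intr_norm ltrz1.
have := ltn_ord i; have := ltn_ord j; move: ij; rewrite -val_eqE /=.
by have [kl|kl|kl] := ltgtP (k - l) 0; nia.
Qed.

Lemma disjoint_copies n : exists (y : 'I_n -> R) (z : 'I_n -> 'S_q -> H),
  [/\ forall i v, v \in Alt -> acts (val (z i v)) (y i) 0 v,
      forall i j v, v \in Alt -> i != j -> acts (val (z i v)) (y j) 0 (1%g : 'S_q) &
      forall i j u v, u \in Alt -> v \in Alt -> i != j ->
        commute (z i u) (z j v)].
Proof.
have [y [r [r0 yw yfar]]] := far_points n.
have [z zP] : {z : 'I_n * 'S_q -> H & forall iv, iv.2 \in Alt ->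
    [/\ acts (val (z iv)) (y iv.1) 0 iv.2, fibrewise (val (z iv)) &
        forall x, far x (y iv.1) r -> acts (val (z iv)) x 0 (1%g : 'S_q)]}.
  apply: (choice (P := fun iv z => iv.2 \in Alt ->
    [/\ acts (val z) (y iv.1) 0 iv.2, fibrewise (val z) &
        forall x, far x (y iv.1) r -> acts (val z) x 0 (1%g : 'S_q)])) => -[i v] /=.
  have [/localizable_Alt lv|nv] := pselect (v \in Alt); last by exists 1%g.
  by have [f Kf fP] := lv (y i) r (yw i) r0; exists (to_subgrp Kf).
exists y, (fun i v => z (i, v)); split=> [i v Av|i j v Av ij|i j u v Au Av ij].
- by have [] := zP (i, v) Av.
- have [_ _ zfar] := zP (i, v) Av; apply: zfar.
  have [//|/(_ 0)] := yfar i j ij (y j).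
  by rewrite mul0r addr0 subrr normr0 leNgt r0.
(* over each fibre one of the two elements acts trivially *)
have [_ fu zu] := zP (i, u) Au; have [_ fv zv] := zP (j, v) Av.
apply/val_inj/(eq_acts q_gt0) => x _; have [t ut] := fu x; have [t' vt] := fv x.
have [/zu u1|/zv v1] := yfar i j ij x.
  by exists 0, t'; split; [rewrite -[t']mul1g | rewrite -[t']mulg1]; apply: actsM0.
by exists 0, t; split; [rewrite -[t]mulg1 | rewrite -[t]mul1g]; apply: actsM0.
Qed.

End Localized.

(** * Neither virtually solvable nor linear *)

Section FiniteIndex.
Variable G : groupType.
Local Open Scope group_scope.

(** The families of cosets indexed by the finite set [V] form a finite set, to which
    the pigeonhole principle applies. *)
Lemma finite_index_collision (S : groupClosed G) (V : finType) :
    finite_index S -> exists n, forall z : 'I_n -> V -> G,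
  exists i j, i != j /\ forall v, (z i v)^-1 * z j v \in S.
Proof.
pose cos x := [set x * y | y in [set` (S : {pred G})]]%classic.
move=> /finite_seqP[cs csP]; have cosP x : (index (cos x) cs < size cs)%N.
  by rewrite index_mem; have : [set` cs]%classic (cos x) by rewrite -csP; exists x.
pose C := {ffun V -> 'I_(size cs)}.
exists #|C|.+1 => z; pose col i : C := [ffun v => Ordinal (cosP (z i v))].
have [i [j [ij colE]]] : exists i j, i != j /\ col i = col j.
  apply: contrapT => no; have /leq_card : injective col.
    by move=> i j cij; apply: contrapT => /eqP ij; apply: no; exists i, j.
  by rewrite card_ord ltnn.
exists i, j; split=> // v; have := congr1 (fun f : C => val (f v)) colE.
rewrite !ffunE /= => E.
have : cos (z i v) = cos (z j v).
  have mem x : cos x \in cs by rewrite -index_mem.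
  by rewrite -(nth_index (cos 1) (mem (z i v))) E nth_index.
move=> cosE; have : cos (z j v) (z j v) by exists 1; rewrite ?mulg1 //; apply: gpred1.
by rewrite -cosE => -[y Sy <-]; rewrite mulKg.
Qed.

(** The matrices [b i] are linearly independent: the commutator with [a i] kills
    all of them except [b i]. *)
Lemma linear_noncommuting_pairs (F : fieldType) n (rho : G -> 'M[F]_n) k (a b : 'I_k -> G) :
    injective rho -> (forall x y, rho (x * y) = (rho x *m rho y)%R) ->
    (forall i, ~ commute (a i) (b i)) -> (forall i j, i != j -> commute (a i) (b j)) ->
  (k <= n * n)%N.
Proof.
move=> rho_inj rhoM nc cc.
pose B := (\matrix_(i < k) mxvec (rho (b i)))%R.
suff /eqP <- : row_free B by apply: rank_leq_col.
apply: inj_row_free => c; rewrite mulmx_sum_row => cB.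
have {}cB : (\sum_i c ord0 i *: rho (b i) = 0)%R.
  apply: (can_inj mxvecK); rewrite linear_sum linear0 -{}[RHS]cB.
  by apply: eq_bigr => i _; rewrite rowK linearZ.
apply/rowP => i; rewrite mxE; apply/eqP.
have : (rho (a i) *m (\sum_j c ord0 j *: rho (b j)) - (\sum_j c ord0 j *: rho (b j)) *m rho (a i) = 0)%R.
  by rewrite cB mulmx0 mul0mx subrr.
rewrite mulmx_sumr mulmx_suml -sumrB (bigD1 i) //= big1 => [|j ji].
  rewrite addr0 -scalemxAl -scalemxAr -scalerBr => /eqP; rewrite scaler_eq0 => /orP[//|].
  by rewrite subr_eq0 -!rhoM => /eqP/rho_inj/nc.
by rewrite -scalemxAl -scalemxAr -!rhoM cc 1?eq_sym // subrr.
Qed.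

End FiniteIndex.

Section Large.
Variables (R : realType) (s m q : nat) (alpha : 'I_s -> R) (g : 'I_m -> iet R).
Hypotheses (q_gt0 : (0 < q)%N) (g_in : forall j, G_inv_q q (g j)).
Variable k0 : 'I_s.
Hypothesis irr0 : irrational (alpha k0).
Local Open Scope ring_scope.

Local Notation H := (subgrp (H_AQ alpha g)).
Local Notation P := (symb_sigma q (Q_grp g)).
Local Notation Alt := ('Alt_('I_q))%g.

Hypotheses (q5 : (5 <= q)%N) (AltP : (Alt \subset P)%g).

(** In a subgroup of finite index, some fibre is still permuted by the whole
    alternating group, which is perfect. *)
Lemma H_not_virtually_solvable : ~ virtually solvable_grp H.
Proof.
move=> [S finS [n /derived_triv Dn]].
have [N coll] := @finite_index_collision _ _ 'S_q finS.
have [y [z [zy zj _]]] := disjoint_copies q_gt0 g_in irr0 q5 AltP N.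
have [i [j [ij Sz]]] := coll z; pose x := y j.
have real0 v : v \in Alt -> exists k : subgrp S, acts (val (val k)) x 0 v.
  move=> Av; exists (to_subgrp (Sz v)).
  have := actsM0 (actsV0 (zj i j v Av ij)) (zy j v Av).
  by rewrite invg1 mul1g.
have perfect : (Alt^`(1) = Alt)%g.
  apply: (Alt_normal_sub q5); [exact: der_sub | exact: der_norm |].
  by rewrite (sameP eqP derG1P) Alt_not_abelian.
have real k v : v \in Alt -> exists2 c : subgrp S, c \in @derived (subgrp S) k & acts (val (val c)) x 0 v.
  elim: k v => [|k IHk] v; first by move=> /real0[c cv]; exists c.
  rewrite -{1}perfect derg1; move: v; apply: gen_set_ind => [|u v [c Dc cu] [d Dd dv]|_ /imset2P[u v Au Av ->]].
  - by exists 1%g; [exact: derived1 | exact: acts1].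
  - exists (c * d)%g; first exact: derivedM.
    by rewrite (val_subgrpM c d) (val_subgrpM (val c) (val d)); apply: (actsM0 cu dv).
  - have [c Dc cu] := IHk u Au; have [d Dd dv] := IHk v Av.
    exists [~ c, d]%g; first exact: derivedR.
    by rewrite (val_subgrpR c d) (val_subgrpR (val c) (val d)); apply: (actsR0 cu dv).
have /negP[] := Alt_not_abelian q5; rewrite (_ : Alt = 1%g) ?abelian1 //.
apply/trivgP/fintype.subsetP => v /(real n)[c /Dn -> cv]; rewrite inE.
exact/eqP/(acts_uniq q_gt0 cv)/acts1.
Qed.

Lemma H_not_virtually_nilpotent : ~ virtually nilpotent_grp H.
Proof. by move=> /(virtually_mono nilpotent_solvable)/H_not_virtually_solvable. Qed.

Lemma H_not_linear : ~ linear_grp H.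
Proof.
move=> [F [n [rho [rho_inj _ rhoM]]]].
have [y [z [zy _ zz]]] := disjoint_copies q_gt0 g_in irr0 q5 AltP (n * n).+1.
have [u [v [Au Av uv]]] : exists u v : 'S_q, [/\ u \in Alt, v \in Alt & ~ commute u v].
  apply: contrapT => no; have /negP[] := Alt_not_abelian q5.
  apply/centsP => u Au v Av; apply: contrapT => uv; apply: no; by exists u, v.
suff : ((n * n).+1 <= n * n)%N by rewrite ltnn.
apply: (linear_noncommuting_pairs rho_inj rhoM (a := fun i => z i u) (b := fun i => z i v)).
  2: by move=> i j; apply: zz.
move=> i zc.
apply: uv; apply: (acts_uniq q_gt0 (f := val (z i u * z i v)%g) (x := y i) (d := 0)).
  by apply: actsM0; apply: zy.
by rewrite zc; apply: actsM0; apply: zy.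
Qed.

Lemma H_free_semigroup : has_free_semigroup2 H.
Proof.
have [u Qu u_nc] := symb_not_central q5 AltP.
apply: (free_semigroup_H q_gt0 irr0 u_nc (symb_H alpha Qu)).
by have := rotation_H alpha g k0 1 0; rewrite mul1r addr0.
Qed.

Lemma H_exponential_growth : exponential_growth R H.
Proof.
split; last by move=> S; apply: free_semigroup_growth; apply: H_free_semigroup.
apply: (@generates_subgrp _ _ ([seq rotation (alpha k) | k : 'I_s] ++ [seq g j | j : 'I_m])).
move=> _ [[k _ <-]|[j _ <-]]; rewrite mem_cat; apply/orP; [left | right].
  by apply/mapP; exists k; rewrite ?mem_enum.
by apply/mapP; exists j; rewrite ?mem_enum.
Qed.

Lemma Q_not_rotations : exists2 h, h \in Q_grp g & forall a : R, h <> rotation a.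
Proof.
have [u Qu u_nc] := symb_not_central q5 AltP.
exists (E R u) => [|a /rotation_E_commute-/(_ q_gt0) //]; by rewrite -mem_symb.
Qed.

End Large.

Theorem theorem2 (R : realType) (s m q : nat)
    (alpha : 'I_s -> R) (g : 'I_m -> iet R)
    (s_ge1 : (1 <= s)%N) (m_ge1 : (1 <= m)%N) (q_ge1 : (1 <= q)%N)
    (alpha_irrational : forall i, irrational (alpha i))
    (alpha_independent : Q_independent alpha)
    (g_in : forall j, G_inv_q q (g j)) :
  let Q := Q_grp g in
  let H := subgrp (H_AQ alpha g) : groupType in
  let P := symb_sigma q Q in
  ((5 <= q)%N -> ('Alt_('I_q) \subset P)%g ->
     (exists2 h, h \in Q & forall a : R, h <> rotation a) /\
     (elementary_amenable H /\ EG 2 H) /\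
     ~ virtually nilpotent_grp H /\
     has_free_semigroup2 H /\
     exponential_growth R H /\
     ~ virtually solvable_grp H /\
     ~ linear_grp H)
  /\
  (forall p : nat, (1 <= p)%N -> (q, p) <> (1, 1)%N ->
     (p_solvable p H <-> p_solvable p [subg P])).
Proof.
move=> Q H P.
pose k0 := Ordinal s_ge1; have irr0 := alpha_irrational k0.
split=> [q5 AltP|p]; last exact: (p_solvable_H q_ge1 g_in irr0).
have EG2 := EG2_H q_ge1 alpha g_in.
split; first exact: Q_not_rotations AltP.
split; first by split=> //; apply: EG_elementary_amenable EG2.
split; first exact: (H_not_virtually_nilpotent q_ge1 g_in irr0).
split; first exact: (H_free_semigroup q_ge1 irr0).
split; first exact: (H_exponential_growth q_ge1 irr0).
split; first exact: (H_not_virtually_solvable q_ge1 g_in irr0).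
exact: (H_not_linear q_ge1 g_in irr0).
Qed.
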